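(* Let $S$ be a finite multiset of integers and let $d\ge 0$. There is a bijection between dual Dyck factorizations $\mathcal F=(F_0,F_1,\ldots)$ of the multiset $S$ satisfying $\mathrm{di}(F_0F_1\cdots)=d$ and pairs $(P,Q)$ such that: (i) $P$ is a Dyck tableau with entries exactly the multiset $S$ and $\mathrm{di}(\mathrm{RR}(P))=d$; (ii) $Q$ is a semistandard Young tableau (with entries in $\{0,1,2,\ldots\}$) of the same shape as $P$; (iii) the content of $Q$ records the factorization weight, meaning that if $\mathcal F$ corresponds to $(P,Q)$ then $m_i(Q)=|F_i|$ for every $i\ge 0$. Equivalently (for (iii)), the bijection sends the factorization monomial $\prod_{i\ge 0}x_i^{|F_i|}$ to the semistandard-tableau weight of $Q$.
   Context: Sequences are finite integer sequences indexed from $0$, possibly empty; $|F|$ is the length of $F$. For $x=(x_0,\ldots,x_{m-1})$, $\mathrm{di}(x)=\#\{(i,j):0\le i<j<m,\ x_i=x_j+1\}$. A sequence $x$ is dual Dyck if $x_{i+1}\ge x_i+2$ for all $0\le i<m-1$. A factorization of $S$ is an ordered sequence $\mathcal F=(F_0,F_1,F_2,\ldots)$ of finite sequences, all but finitely many empty, such that the concatenation $F_0F_1F_2\cdots$ is a permutation (rearrangement) of the multiset $S$; it is a dual Dyck factorization if each $F_i$ is a dual Dyck sequence. A Dyck tableau is a left-aligned tableau with rows $T_0,T_1,\ldots,T_{\ell-1}$ from top to bottom (nonempty rows; the tableau with no rows is allowed), with $|T_0|\ge|T_1|\ge\cdots\ge|T_{\ell-1}|$, such that each row read left to right is a dual Dyck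 sequence, and whenever adjacent rows $T_j$ and $T_{j+1}$ both have an entry in column $p$, $T_j[p]\le T_{j+1}[p]+1$. Its row-reading word is $\mathrm{RR}(P)=T_{\ell-1}T_{\ell-2}\cdots T_0$ (rows read left to right, bottom row first). Its shape $\lambda(P)$ is the partition of row lengths. A semistandard Young tableau has rows weakly increasing left to right and columns strictly increasing top to bottom; $m_i(Q)$ is the number of entries of $Q$ equal to $i$, and the weight of $Q$ is $\prod_{i\ge0}x_i^{m_i(Q)}$. *)

(* Defs.v *)
From HB Require Import structures.
From mathcomp Require Import all_boot all_order all_algebra.
From mathcomp Require Import finmap multiset.

Set Implicit Arguments.
Unset Strict Implicit.
Unset Printing Implicit Defensive.

Import Order.TTheory GRing.Theory Num.Theory.

Local Open Scope fset_scope.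
Local Open Scope fmap_scope.
Local Open Scope mset_scope.
Local Open Scope ring_scope.

Definition di (x : seq int) : nat :=
  #|[set ij : 'I_(size x) * 'I_(size x) |
      (ij.1 < ij.2)%N && (x`_ij.1 == x`_ij.2 + 1)]|.

Definition dual_dyck (x : seq int) : bool :=
  sorted (fun a b : int => a + 2 <= b) x.

(* Finitely supported families of sequences (F_0, F_1, ...). *)
Notation seq_family := {fsfun nat -> seq int with [::]}.

(* F_0 F_1 F_2 ...: the terms outside the finite support are empty. *)
Definition fconcat (F : seq_family) : seq int :=
  flatten [seq F i | i <- sort leq (finsupp F)].

Definition is_factorization (S : {mset int}) (F : seq_family) : bool :=
  perm_eq (fconcat F) S.

(* The factors outside the support, being empty, are trivially dual Dyck. *)
Definition is_dual_dyck_factorization (S : {mset int}) (F : seq_family) : bool :=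
  is_factorization S F && all (fun i => dual_dyck (F i)) (finsupp F).

(* A left-aligned tableau is the list of its rows, from top to bottom; its
   shape is the list [shape T] of its row lengths, required here to be a
   partition. *)
Definition partition_shaped (A : Type) (T : seq (seq A)) : bool :=
  all (fun n => 0 < n)%N (shape T) && sorted geq (shape T).

(* Every two vertically adjacent entries a (above) and b (below) satisfy R a b;
   [zip r s] lists the pairs of entries of the rows r and s over the columns in
   which both rows have an entry. *)
Definition columns_satisfy (A : Type) (R : rel A) (T : seq (seq A)) : bool :=
  sorted (fun r s => all (fun ab => R ab.1 ab.2) (zip r s)) T.

Definition is_dyck_tableau (P : seq (seq int)) : bool :=
  [&& partition_shaped P, all dual_dyck P
    & columns_satisfy (fun a b : int => a <= b + 1) P].

Definition row_reading (P : seq (seq int)) : seq int := flatten (rev P).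

Definition is_ssyt (Q : seq (seq nat)) : bool :=
  [&& partition_shaped Q, all (sorted leq) Q & columns_satisfy ltn Q].

(* m_i(Q) *)
Definition mult (i : nat) (Q : seq (seq nat)) : nat := count_mem i (flatten Q).

Definition dual_dyck_factorization (S : {mset int}) (d : nat) : Type :=
  {F : seq_family | is_dual_dyck_factorization S F && (di (fconcat F) == d)}.

Definition tableau_pair (S : {mset int}) (d : nat) : Type :=
  {PQ : seq (seq int) * seq (seq nat) |
    [&& is_dyck_tableau PQ.1, perm_eq (flatten PQ.1) S,
        di (row_reading PQ.1) == d, is_ssyt PQ.2
      & shape PQ.2 == shape PQ.1]}.

(* Main.v *)
(** The bijection is a Robinson-Schensted-Knuth correspondence that inserts
    whole factors. For two dual Dyck rows X, Y, the union of their values splits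
    into maximal runs of consecutive integers; in a run the rows alternate
    (unless it is a value common to both), and exchanging the two rows inside a
    run of odd length preserves both rows being dual Dyck and di(XY), while it
    moves one unit of length. Reading the odd runs from left to right as
    arrivals (starting in Y) and services (starting in X) of a queue, and
    exchanging the runs of the unused services, turns XY into a word VU in which
    U over V is a Dyck tableau; time reversal of the queue inverts this. To
    insert a factor F into a tableau, apply this move to the top row and F, pass
    V on to the next row, and so on. In terms of the counting functions
    x(t) = #{a in X : a < t}, U over V is a Dyck pair when v(t) <= u(t+1) for
    all t, and u is, up to a defect inside the exchanged runs, the max-plus
    expression y(t) + max(0, max_{s <= t} x(s) - y(s+1)). These formulas show
    that insertion and its inverse preserve tableaux, and that the shapes
    interlace; the successive shapes then form the semistandard tableau Q. *)

Require Import Defs.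
From HB Require Import structures.
From mathcomp Require Import all_boot all_order all_algebra.
From mathcomp Require Import finmap multiset zify.

Set Implicit Arguments.
Unset Strict Implicit.
Unset Printing Implicit Defensive.

Import Order.TTheory GRing.Theory Num.Theory.

Local Open Scope mset_scope.

(** * The queue on a pair of rows *)

(* A pair of rows is encoded by its columns: entry t tells whether the t-th value
   lies in the first row and whether it lies in the second row. *)
Notation cols := (seq (bool * bool)).

(** Parity of the length of the longest prefix of columns with exactly one entry. In a valid word
    such columns alternate, so this prefix is a run. *)
Fixpoint odd_run (w : cols) : bool :=
  if w is c :: w' then (c.1 (+) c.2) && ~~ odd_run w' else false.

(* [q] is the queue length. A run starting in the first row can only be exchanged
   when it is met with an empty queue, and then only if its length is odd; the
   columns of such a run are treated two at a time, because this leaves the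
   parity of the rest of the run unchanged. Along any other run the queue length
   simply follows the columns. *)
Fixpoint queue_scan (q : nat) (w : cols) : cols :=
  match w with
  | [::] => [::]
  | (true, false) :: w1 =>
      if q is q'.+1 then (true, false) :: queue_scan q' w1
      else match w1 with
           | (false, true) :: w2 =>
               if odd_run w2 then [:: (false, true), (true, false) & queue_scan 0 w2]
               else [:: (true, false), (false, true) & queue_scan 0 w2]
           | _ => (false, true) :: queue_scan 0 w1
           end
  | (false, true) :: w1 => (false, true) :: queue_scan q.+1 w1
  | c :: w1 => c :: queue_scan q w1
  end.

(** Follows the branches of [queue_scan]: a service met with an empty queue is lost, and an arrival
    right after it belongs to the same run and is not queued. *)
Fixpoint final_queue (q : nat) (w : cols) : nat :=
  match w with
  | [::] => q
  | (true, false) :: w1 =>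
      if q is q'.+1 then final_queue q' w1
      else if w1 is (false, true) :: w2 then final_queue 0 w2 else final_queue 0 w1
  | (false, true) :: w1 => final_queue q.+1 w1
  | _ :: w1 => final_queue q w1
  end.

(** Functional induction along the branches of [queue_scan]; it goes by size because one branch
    consumes two columns. *)
Lemma scan_ind (P : nat -> cols -> Prop) :
  (forall q, P q [::]) ->
  (forall q b w, P q w -> P q ((b, b) :: w)) ->
  (forall q w, P q.+1 w -> P q ((false, true) :: w)) ->
  (forall q w, P q w -> P q.+1 ((true, false) :: w)) ->
  (forall w, P 0 w -> P 0 [:: (true, false), (false, true) & w]) ->
  (forall w, head (false, false) w != (false, true) -> P 0 w ->
     P 0 ((true, false) :: w)) ->
  forall q w, P q w.
Proof.
move=> P0 Pb Py Px Pxy Pxe q w.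
have [n] := ubnP (size w); elim: n q w => // n IHn q [|[x y] w] //= /[!ltnS] szw.
case: x y => [] [].
- exact/Pb/IHn.
- case: q => [|q]; last exact/Px/IHn.
  case: w szw => [|[[] []] w] szw; try exact/Pxe/IHn.
  by apply/Pxy/IHn; apply: ltnW.
- exact/Py/IHn.
- exact/Pb/IHn.
Qed.

Lemma scan_bb q b w : queue_scan q ((b, b) :: w) = (b, b) :: queue_scan q w.
Proof. by case: b. Qed.

Lemma final_queue_bb q b w : final_queue q ((b, b) :: w) = final_queue q w.
Proof. by case: b. Qed.

Lemma scan_xe w : head (false, false) w != (false, true) ->
  queue_scan 0 ((true, false) :: w) = (false, true) :: queue_scan 0 w.
Proof. by case: w => [|[[] []] w]. Qed.

Lemma final_queue_xe w : head (false, false) w != (false, true) ->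
  final_queue 0 ((true, false) :: w) = final_queue 0 w.
Proof. by case: w => [|[[] []] w]. Qed.

Lemma size_scan q w : size (queue_scan q w) = size w.
Proof.
move: q w; apply: scan_ind => // [q b w|q w|q w|w|w hw] IH; rewrite ?scan_bb ?(scan_xe hw) //=.
- by rewrite IH.
- by rewrite IH.
- by rewrite IH.
- by case: ifP => _ /=; rewrite IH.
- by rewrite IH.
Qed.

(** Neither row contains two consecutive integers: this is the dual Dyck condition on both rows at
    once. *)
Definition compat (c d : bool * bool) := ~~ (c.1 && d.1) && ~~ (c.2 && d.2).
Definition valid (w : cols) := sorted compat w.

Lemma valid_cons c w : valid (c :: w) = compat c (head (false, false) w) && valid w.
Proof. by case: w => //=; rewrite /compat !andbF. Qed.

(** The first column changes only when it opens an exchanged run. Adjacency arguments need nothing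
    else about the scanned tail. *)
Lemma scan_head q w : valid w -> head (false, false) (queue_scan q w) =
  let c := head (false, false) w in
  if [&& q == 0, c.1, ~~ c.2 & odd_run w] then (false, true) else c.
Proof.
case: w => [|[[] []] w] /=; rewrite ?andbF //=.
case: q => //=; case: w => [|[[] []] w] //=; rewrite /compat //=.
by rewrite negbK; case: ifP.
Qed.

Lemma scan_valid q w : valid w -> valid (queue_scan q w).
Proof.
move: q w; apply: scan_ind => // [q b w|q w|q w|w|w hw] IH; rewrite ?scan_bb ?(scan_xe hw) //.
- rewrite !valid_cons => /andP[cw /[dup] vw /IH ->]; rewrite scan_head //=.
  move: cw; case: b; case: (head _ w) => [] [] [] //=; rewrite ?andbF //.
- rewrite [queue_scan _ _]/= !valid_cons => /andP[cw /[dup] vw /IH ->]; rewrite scan_head //=.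
  by rewrite cw.
- rewrite [queue_scan _ _]/= !valid_cons => /andP[cw /[dup] vw /IH ->]; rewrite scan_head //=.
  by move: cw; case: (head _ w) => [] [] [] //=; rewrite ?andbF.
- rewrite [queue_scan _ _]/= !valid_cons => /and3P[_ cw /[dup] vw /IH vs].
  have /= hs := scan_head 0 vw.
  case: ifP => ow; rewrite !valid_cons vs hs ow /=.
    by move: cw ow; case: w {hs IH vw vs} => [|[[] []] w].
  by move: cw; case: (head _ w) => [] [] [] //=; rewrite ?andbF.
- rewrite !valid_cons => /andP[cw /[dup] vw /IH ->]; rewrite scan_head //=.
  by move: cw hw; case: (head _ w) => [] [] [] //=; rewrite ?andbF.
Qed.

Definition fst_count t (w : cols) := count fst (take t w).
Definition snd_count t (w : cols) := count snd (take t w).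

Lemma fst_countS t c w : fst_count t.+1 (c :: w) = c.1 + fst_count t w. Proof. by []. Qed.
Lemma snd_countS t c w : snd_count t.+1 (c :: w) = c.2 + snd_count t w. Proof. by []. Qed.
Lemma fst_count0 w : fst_count 0 w = 0. Proof. by rewrite /fst_count take0. Qed.
Lemma snd_count0 w : snd_count 0 w = 0. Proof. by rewrite /snd_count take0. Qed.

Lemma snd_count1 w : snd_count 1 w = (head (false,false) w).2.
Proof. by case: w => [|c w] //; rewrite snd_countS snd_count0 addn0. Qed.

Definition col_countE := (fst_countS, snd_countS, fst_count0, snd_count0).

Lemma scan_cnt q w t :
  fst_count t (queue_scan q w) + snd_count t (queue_scan q w) = fst_count t w + snd_count t w.
Proof.
move: q w t; apply: scan_ind => // [q b w|q w|q w|w|w hw] IH [|t];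
  rewrite ?scan_bb ?(scan_xe hw) /= ?[in LHS]col_countE ?[in RHS]col_countE //=;
  first [by have := IH t; lia | case: ifP => _].
all: by case: t => [|t]; rewrite !col_countE //=; have := IH t; lia.
Qed.

Lemma scan_fin q w t : size w <= t ->
  snd_count t (queue_scan q w) + q = fst_count t w + final_queue q w.
Proof.
move: q w t; apply: scan_ind => // [q b w|q w|q w|w|w hw] IH [|t] szt //;
  rewrite ?scan_bb ?final_queue_bb ?(scan_xe hw) ?(final_queue_xe hw) /= ?col_countE //=;
  first [by have := IH t; move: szt => /=; lia | case: ifP => _].
all: by case: t szt => [|t] // szt; rewrite !col_countE /=; have := IH t; move: szt => /=; lia.
Qed.

Lemma scan_ge q w t : snd_count t w <= snd_count t (queue_scan q w).
Proof.
move: q w t; apply: scan_ind => // [q b w|q w|q w|w|w hw] IH [|t];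
  rewrite ?scan_bb ?(scan_xe hw) /= ?col_countE //=;
  first [by have := IH t; lia | case: ifP => _].
all: by case: t => [|t]; rewrite !col_countE //=; have := IH t; lia.
Qed.

Lemma scan_lower q w s t : s <= t ->
  fst_count s w + snd_count t w <= snd_count t (queue_scan q w) + snd_count s.+1 w + q.
Proof.
move: q w s t; apply: scan_ind => // [q b w|q w|q w|w|w hw] IH [|s] [|t] // st;
  rewrite ?scan_bb ?(scan_xe hw) ?[queue_scan _ _]/= ?col_countE //=.
- by have := scan_ge q w t; lia.
- by have := IH s t; lia.
- by have := scan_ge q.+1 w t; lia.
- by have := IH s t; lia.
- by have := scan_ge q w t; lia.
- by have := IH s t; lia.
- by have := scan_ge 0 w t.-1; case: ifP => _; case: t st => [|t] st; rewrite !col_countE /=; lia.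
- case: ifP => _; case: s t st => [|s] [|t] // st; rewrite !col_countE /=.
  + by have := scan_ge 0 w t; lia.
  + by have := IH s t; lia.
  + by have := scan_ge 0 w t; lia.
  + by have := IH s t; lia.
- by have := scan_ge 0 w t; lia.
- by have := IH s t; lia.
Qed.

(* The third alternative occurs strictly inside an exchanged run, at the positions
   where the result is ahead of the max-plus formula by one. *)
Lemma scan_upper q w t : valid w ->
  [\/ snd_count t (queue_scan q w) = snd_count t w,
   exists2 s, s <= t &
     snd_count t (queue_scan q w) + snd_count s.+1 w + q = snd_count t w + fst_count s w |
   [/\ fst_count t w <= snd_count t (queue_scan q w) + q, (nth (false, false) w t).2
     & (nth (false, false) (queue_scan q w) t.+1).2]].
Proof.
move: q w t; apply: scan_ind => [q|q b w|q w|q w|w|w hw] IH t; first by constructor 1.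
all: case: t => [|t]; first by (move=> _; constructor 1; rewrite !col_countE).
- rewrite valid_cons => /andP[_ /IH{}IH]; rewrite scan_bb.
  case: (IH t) => [e|[s st e]|[l n1 n2]].
  + by constructor 1; rewrite !col_countE e.
  + by constructor 2; exists s.+1; rewrite // !col_countE /=; lia.
  + by constructor 3; rewrite !col_countE /=; split => //; lia.
- rewrite valid_cons => /andP[_ /IH{}IH]; rewrite [queue_scan _ _]/=.
  case: (IH t) => [e|[s st e]|[l n1 n2]].
  + by constructor 1; rewrite !col_countE e.
  + by constructor 2; exists s.+1; rewrite // !col_countE /=; lia.
  + by constructor 3; rewrite !col_countE /=; split => //; lia.
- rewrite valid_cons => /andP[_ /IH{}IH]; rewrite [queue_scan _ _]/=.
  case: (IH t) => [e|[s st e]|[l n1 n2]].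
  + by constructor 1; rewrite !col_countE e.
  + by constructor 2; exists s.+1; rewrite // !col_countE /=; lia.
  + by constructor 3; rewrite !col_countE /=; split => //; lia.
- rewrite !valid_cons => /and3P[_ cw /[dup] vw /IH{}IH]; rewrite [queue_scan _ _]/=.
  case: t => [|t].
    case: ifP => ow; last by constructor 1; rewrite !col_countE.
    (* The cut falls between two exchanged columns. The run is odd, so it goes on with a service,
       which is exchanged too. *)
    constructor 3; rewrite !col_countE /=; split => //.
    have /= hs := scan_head 0 vw; rewrite nth0 hs ow.
    by move: cw ow; case: w {hs IH vw} => [|[[] []] w].
  case: (IH t) => [e|[s st e]|[l n1 n2]].
  + by constructor 1; case: ifP => _; rewrite !col_countE e.
  + by constructor 2; case: ifP => _; exists s.+2; rewrite // !col_countE /=; lia.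
  + by constructor 3; case: ifP => _; rewrite !col_countE /=; split => //; lia.
- rewrite !valid_cons => /andP[cw /IH{}IH]; rewrite scan_xe //.
  case: (IH t) => [e|[s st e]|[l n1 n2]].
  (* The lone service at the end of the run attains the maximum: x(1) = 1, and y(2) = 0 because the
     next column is empty. *)
  + constructor 2; exists 1; rewrite // !col_countE e snd_count1.
    by move: cw hw; case: (head _ w) => [] [] [] //=; rewrite ?andbF //=; lia.
  + by constructor 2; exists s.+1; rewrite // !col_countE /=; lia.
  + by constructor 3; rewrite !col_countE /=; split => //; lia.
Qed.

(* The [di] of the first row followed by the second one: see [cross_ints]. *)
Fixpoint yx_count (w : cols) : nat :=
  if w is c :: w' then (c.2 && (head (false, false) w').1) + yx_count w' else 0.

(** A run of 2k+1 alternating columns has k places where a second-row column precedes a first-row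
    one, whichever row opens it; validity keeps distinct runs apart. *)
Lemma scan_yx q w : valid w -> yx_count (queue_scan q w) = yx_count w.
Proof.
move: q w; apply: scan_ind => // [q b w|q w|q w|w|w hw] IH; rewrite ?scan_bb ?(scan_xe hw) //.
- rewrite valid_cons => /andP[cw /[dup] vw /IH{}IH] /=; rewrite IH scan_head //=.
  by move: cw; case: b; case: (head _ w) => [] [] [] //=; rewrite ?andbF.
- rewrite valid_cons => /andP[cw /[dup] vw /IH{}IH] /=; rewrite IH scan_head //=.
- by rewrite valid_cons => /andP[cw /[dup] vw /IH{}IH] /=; rewrite IH.
- rewrite !valid_cons => /and3P[_ cw /[dup] vw /IH{}IH] /=.
  have /= hs := scan_head 0 vw.
  case: ifP => ow /=; rewrite IH ?hs ?ow.
    by move: cw ow; case: w {hs IH vw} => [|[[] []] w].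
  by rewrite !andbF.
- rewrite valid_cons => /andP[cw /[dup] vw /IH{}IH] /=; rewrite IH scan_head //=.
  by move: cw hw; case: (head _ w) => [] [] [] //=; rewrite ?andbF.
Qed.

(* Time reversal: running the queue backwards exchanges arrivals and services. *)
Definition mirror (w : cols) : cols := rev [seq (c.2, c.1) | c <- w].

Lemma mirrorK : involutive mirror.
Proof. by move=> w; rewrite /mirror map_rev revK -map_comp map_id_in // => [] []. Qed.

Lemma mirror_cat v w : mirror (v ++ w) = mirror w ++ mirror v.
Proof. by rewrite /mirror map_cat rev_cat. Qed.

Lemma odd_run_cat w b v : odd_run (w ++ (b, b) :: v) = odd_run w.
Proof. by elim: w => [|c w /= ->] //=; rewrite addbb. Qed.

(** An empty or doubled column ends every run, so only the queue length is carried across it. *)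
Lemma scan_cat q w b v :
  queue_scan q (w ++ (b, b) :: v) = queue_scan q w ++ (b, b) :: queue_scan (final_queue q w) v.
Proof.
move: q w; apply: scan_ind => [q|q c w IH|q w IH|q w IH|w IH|w hw IH].
- by rewrite scan_bb.
- by rewrite [_ ++ _]/= !scan_bb IH final_queue_bb.
- by rewrite /= IH.
- by rewrite /= IH.
- by rewrite /= odd_run_cat IH; case: ifP.
- by rewrite [_ ++ _]/= !scan_xe ?IH ?(final_queue_xe hw) //; move: hw; case: w {IH}; case: b.
Qed.

Lemma final_queue_cat q w b v : final_queue q (w ++ (b, b) :: v) = final_queue (final_queue q w) v.
Proof.
move: q w; apply: scan_ind => [q|q c w IH|q w IH|q w IH|w IH|w hw IH].
- by rewrite final_queue_bb.
- by rewrite [_ ++ _]/= !final_queue_bb IH.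
- by rewrite /= IH.
- by rewrite /= IH.
- by rewrite /= IH.
- by rewrite [_ ++ _]/= !final_queue_xe ?IH //; move: hw; case: w {IH}; case: b.
Qed.

Fixpoint alt (b : bool) (n : nat) : cols :=
  if n is n'.+1 then (b, ~~ b) :: alt (~~ b) n' else [::].

Lemma odd_run_alt b n : odd_run (alt b n) = odd n.
Proof. by elim: n b => //= n IH b; rewrite IH; case: b. Qed.

Lemma scan_alt q b n :
  queue_scan q (alt b n) = if [&& q == 0, b & odd n] then alt (~~ b) n else alt b n.
Proof.
have [k] := ubnP n; elim: k q b n => // k IH q b [|[|n]] /= nk.
- by rewrite !andbF.
- by rewrite !andbT; case: b; case: q.
have {}IH q' b' : queue_scan q' (alt b' n) =
    if [&& q' == 0, b' & odd n] then alt (~~ b') n else alt b' n.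
  by apply: IH; lia.
by case: b => /=; [case: q => [|q] /=|]; rewrite ?odd_run_alt ?negbK IH ?andbF //=; case: (odd n).
Qed.

Lemma final_queue_alt q b n :
  final_queue q (alt b n) = if odd n then if b then q.-1 else q.+1 else q.
Proof.
have [k] := ubnP n; elim: k q b n => // k IH q b [|[|n]] //= nk.
- by case: b; case: q.
by case: b => /=; [case: q => [|q] /=|]; rewrite IH ?negbK //; lia.
Qed.

Lemma alt_rcons b n : rcons (alt b n) (b (+) odd n, ~~ (b (+) odd n)) = alt b n.+1.
Proof.
elim: n b => [|n IH] b /=; rewrite ?addbF //.
by have /= <- := IH (~~ b); rewrite addbN addNb.
Qed.

Lemma mirror_alt b n : mirror (alt b n) = alt (b (+) odd n) n.
Proof.
elim: n b => [|n IH] b //; rewrite -alt_rcons -cats1 mirror_cat IH /=.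
by congr (_ :: _); case: b; case: (odd n).
Qed.

Lemma alt_split w : valid w ->
  exists b n, w = alt b n \/ exists c v, w = alt b n ++ (c, c) :: v.
Proof.
elim: w => [|[x y] w IH]; first by exists true, 0; left.
rewrite valid_cons => /andP[cw /IH [b [n e]]].
case: (eqVneq x y) => [<-|xy]; first by exists true, 0; right; exists x, w.
have ? : y = ~~ x by case: x y xy {cw} => [] [].
subst y => {xy}.
case: n e => [|n] e.
  exists x, 1; case: e => [->|[c [v ->]]]; first by left.
  by right; exists c, v.
exists x, n.+2; have -> : alt x n.+2 = (x, ~~ x) :: alt b n.+1.
  have : head (false, false) w = (b, ~~ b) by case: e => [->|[c [v ->]]].
  by move=> hw; move: cw; rewrite hw; clear; case: x; case: b.
by case: e => [->|[c [v ->]]]; [left | right; exists c, v].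
Qed.

(** Cut the word at its columns [(c, c)]. Time reversal reverses the order of the pieces and turns
    the final queue of each into its initial queue, so a single run has to be checked, and there
    everything is explicit. *)
Lemma scanK q w : valid w ->
  mirror (queue_scan (final_queue q w) (mirror (queue_scan q w))) = w /\
  final_queue (final_queue q w) (mirror (queue_scan q w)) = q.
Proof.
suff H : valid w -> queue_scan (final_queue q w) (mirror (queue_scan q w)) = mirror w /\
   final_queue (final_queue q w) (mirror (queue_scan q w)) = q.
  by move=> /H[-> ->]; rewrite mirrorK.
have [k] := ubnP (size w); elim: k q w => // k IH q w wk vw.
have Halt b n p :
   queue_scan (final_queue p (alt b n)) (mirror (queue_scan p (alt b n))) = mirror (alt b n) /\
   final_queue (final_queue p (alt b n)) (mirror (queue_scan p (alt b n))) = p.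
  rewrite scan_alt final_queue_alt.
  case o: (odd n); case: b; case: p => [|p] /=;
    rewrite !mirror_alt scan_alt final_queue_alt ?o ?andbF //=.
have [b [m [e|[c [v e]]]]] := alt_split vw; first by rewrite e; apply: Halt.
rewrite e scan_cat final_queue_cat mirror_cat (mirror_cat (alt b m)).
have vv : valid v.
  by move: vw; rewrite e => /cat_sorted2[_]; rewrite -/(valid (_ :: _)) valid_cons => /andP[].
have [|IH1 IH2] := IH (final_queue q (alt b m)) v _ vv.
  by move: wk; rewrite e size_cat /=; lia.
rewrite /mirror !map_cons !rev_cons -!/(mirror _) /= !cat_rcons scan_cat final_queue_cat IH1 IH2.
by have [-> ->] := Halt b m q.
Qed.

(** * Insertion of a row into a row *)

Notation bitrow := (seq bool).
Definition prefix_count (b : bitrow) t := count id (take t b).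
Definition weight (b : bitrow) := count id b.
Definition noadj (b : bitrow) := sorted (fun c d => ~~ (c && d)) b.

Lemma prefix_countS b t : prefix_count b t.+1 = prefix_count b t + nth false b t.
Proof.
rewrite /prefix_count; case: (ltnP t (size b)) => tb.
  by rewrite (take_nth false) // -cats1 count_cat /= addn0.
by rewrite !take_oversize ?nth_default ?addn0 //; lia.
Qed.

Lemma prefix_count0 b : prefix_count b 0 = 0. Proof. by rewrite /prefix_count take0. Qed.

Lemma prefix_count_size b t : size b <= t -> prefix_count b t = weight b.
Proof. by move=> h; rewrite /prefix_count take_oversize. Qed.

Lemma prefix_count_le b s t : s <= t -> prefix_count b s <= prefix_count b t.
Proof. by move=> /subnK <-; elim: (t - s) => // n IH; rewrite addSn prefix_countS; lia. Qed.

Lemma noadj_nth b t : noadj b -> nth false b t -> nth false b t.+1 = false.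
Proof.
elim: b t => [|c b IH] [|t] //; rewrite /noadj /=.
  by case: b {IH} => // d b /andP[/nandP[/negP //|/negbTE]].
by move=> /path_sorted nb; apply: IH.
Qed.

Lemma noadj_prefix_count b t : noadj b -> prefix_count b t.+2 <= (prefix_count b t).+1.
Proof. by move=> nb; rewrite !prefix_countS; have := @noadj_nth b t nb; case: nth => [->|_] //;
  lia. Qed.

Lemma prefix_count_unzip1 w t : prefix_count (unzip1 w) t = fst_count t w.
Proof. by rewrite /prefix_count -map_take count_map. Qed.

Lemma prefix_count_unzip2 w t : prefix_count (unzip2 w) t = snd_count t w.
Proof. by rewrite /prefix_count -map_take count_map. Qed.

Lemma nth_unzip2 w t : nth false (unzip2 w) t = (nth (false, false) w t).2.
Proof. by elim: w t => [|c w IH] [|t] //=. Qed.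

Lemma valid_unzip w : valid w = noadj (unzip1 w) && noadj (unzip2 w).
Proof.
elim: w => // c w IH; rewrite valid_cons IH /noadj /compat.
by case: w {IH} => [|d w] /=; rewrite ?andbF // andbACA.
Qed.

Lemma valid_mirror w : valid (mirror w) = valid w.
Proof.
rewrite /valid /mirror rev_sorted sorted_map; apply: eq_sorted => c d /=.
by rewrite /compat /= andbC (andbC d.1) (andbC d.2).
Qed.

Lemma size_mirror w : size (mirror w) = size w.
Proof. by rewrite size_rev size_map. Qed.

Lemma fst_count_mirror t w :
  fst_count t (mirror w) + prefix_count (unzip2 w) (size w - t) = weight (unzip2 w).
Proof.
rewrite /fst_count take_rev size_map count_rev -map_drop count_map prefix_count_unzip2 addnC.
by rewrite -[w in RHS](cat_take_drop (size w - t)) /weight /unzip2 map_cat count_cat !count_map.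
Qed.

Lemma snd_count_mirror t w :
  snd_count t (mirror w) + prefix_count (unzip1 w) (size w - t) = weight (unzip1 w).
Proof.
rewrite /snd_count take_rev size_map count_rev -map_drop count_map prefix_count_unzip1 addnC.
by rewrite -[w in RHS](cat_take_drop (size w - t)) /weight /unzip1 map_cat count_cat !count_map.
Qed.

(* The result is the pair (bumped row, new row), in reading order. *)
Definition row_insert (X Y : bitrow) : bitrow * bitrow :=
  let w := queue_scan 0 (zip X Y) in (unzip1 w, unzip2 w).

Lemma row_insertE X Y :
  row_insert X Y = (unzip1 (queue_scan 0 (zip X Y)), unzip2 (queue_scan 0 (zip X Y))).
Proof. by []. Qed.

(** [q] is the queue left by the insertion. The pair of rows does not determine it, but by
    [row_insert_weight] it is the growth of the row, which the shapes record. *)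
Definition row_uninsert q (V U : bitrow) : bitrow * bitrow :=
  let w := mirror (queue_scan q (mirror (zip V U))) in (unzip1 w, unzip2 w).

(** The column condition of a Dyck tableau with [U] above [V], as [colrel_dyck_above] shows. Beyond
    [size V] the left count is constant, which makes a finite check enough. *)
Definition dyck_below (V U : bitrow) :=
  all (fun t => prefix_count V t <= prefix_count U t.+1) (iota 0 (size V).+1).

Lemma dyck_belowP V U :
  reflect (forall t, prefix_count V t <= prefix_count U t.+1) (dyck_below V U).
Proof.
apply: (iffP allP) => [h t|h t _]; last exact: h.
case: (leqP t (size V)) => tV; first by apply: h; rewrite mem_iota; lia.
rewrite prefix_count_size ?(ltnW tV) //; rewrite -(@prefix_count_size V (size V)) //.
by apply: (leq_trans (h _ _)); [rewrite mem_iota; lia | apply: prefix_count_le; lia].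
Qed.

Section Rows.
Variable L : nat.

Definition isrow (b : bitrow) := (size b == L) && noadj b.

Lemma isrow_size b : isrow b -> size b = L. Proof. by case/andP=> /eqP. Qed.
Lemma isrow_noadj b : isrow b -> noadj b. Proof. by case/andP. Qed.
Lemma prefix_countL b t : isrow b -> L <= t -> prefix_count b t = weight b.
Proof. by move=> rb Lt; rewrite prefix_count_size // (isrow_size rb). Qed.

Lemma zip_valid X Y : isrow X -> isrow Y ->
  [/\ valid (zip X Y), size (zip X Y) = L, unzip1 (zip X Y) = X & unzip2 (zip X Y) = Y].
Proof.
move=> /andP[/eqP sX nX] /andP[/eqP sY nY].
by rewrite valid_unzip unzip1_zip ?unzip2_zip ?size_zip ?sX ?sY // nX nY minnn.
Qed.

Section Op.
Variables X Y : bitrow.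
Hypotheses (rX : isrow X) (rY : isrow Y).
Let V := (row_insert X Y).1.
Let U := (row_insert X Y).2.

Lemma row_insert_row : isrow V /\ isrow U.
Proof.
have [v s e1 e2] := zip_valid rX rY.
have := scan_valid 0 v; rewrite valid_unzip => /andP[nV nU].
by rewrite /isrow /V /U /row_insert /= !size_map size_scan s eqxx.
Qed.

Lemma row_insert_cnt t : prefix_count V t + prefix_count U t = prefix_count X t + prefix_count Y t.
Proof.
have [v s e1 e2] := zip_valid rX rY.
by rewrite /V /U /row_insert /= prefix_count_unzip1 prefix_count_unzip2 scan_cnt
  -prefix_count_unzip1 -prefix_count_unzip2 e1 e2.
Qed.

Lemma row_insert_ge t : prefix_count Y t <= prefix_count U t.
Proof.
have [v s e1 e2] := zip_valid rX rY.
by rewrite -{1}e2 /U /row_insert /= !prefix_count_unzip2 scan_ge.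
Qed.

Lemma row_insert_lower s t : s <= t ->
  prefix_count X s + prefix_count Y t <= prefix_count U t + prefix_count Y s.+1.
Proof.
have [v sz e1 e2] := zip_valid rX rY.
move=> st; have := scan_lower 0 (zip X Y) st.
by rewrite -!prefix_count_unzip1 -!prefix_count_unzip2 e1 e2 addn0.
Qed.

Lemma row_insert_upper t :
  [\/ prefix_count U t = prefix_count Y t,
   exists2 s, s <= t &
     prefix_count U t + prefix_count Y s.+1 = prefix_count Y t + prefix_count X s |
   [/\ prefix_count X t <= prefix_count U t, nth false Y t & nth false U t.+1]].
Proof.
have [v sz e1 e2] := zip_valid rX rY.
have := scan_upper 0 t v;
  rewrite -!prefix_count_unzip1 -!prefix_count_unzip2 e1 e2 /U /row_insert /=.
case=> [e|[s st e]|[h n1 n2]].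
- by constructor 1.
- by constructor 2; exists s => //; move: e;
  rewrite -!prefix_count_unzip1 -!prefix_count_unzip2 e1 e2; lia.
- constructor 3; split; [by rewrite addn0 in h | | by rewrite nth_unzip2].
  by move: n1; rewrite -nth_unzip2 e2.
Qed.

Lemma row_insert_weight : weight X <= weight U /\ final_queue 0 (zip X Y) = weight U - weight X.
Proof.
have [v sz e1 e2] := zip_valid rX rY.
have [rV rU] := row_insert_row.
have := @scan_fin 0 (zip X Y) L;
  rewrite sz leqnn -!prefix_count_unzip1 -!prefix_count_unzip2 e1 => /(_ isT).
by rewrite -[unzip2 _]/U !prefix_countL //; lia.
Qed.

Lemma row_insertK : row_uninsert (weight U - weight X) V U = (X, Y).
Proof.
have [v sz e1 e2] := zip_valid rX rY.
by rewrite /row_uninsert /= zip_unzip -(row_insert_weight).2 (scanK 0 v).1 e1 e2.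
Qed.

Lemma row_insert_le t : prefix_count V t <= prefix_count X t.
Proof. by have := row_insert_cnt t; have := row_insert_ge t; lia. Qed.

Lemma row_insert_shift t : prefix_count V t <= prefix_count Y t.+1.
Proof. by have := row_insert_cnt t; have := @row_insert_lower t t; lia. Qed.

Lemma row_insert_dom : dyck_below V U.
Proof. by apply/dyck_belowP => t; have := row_insert_shift t; have := row_insert_ge t.+1; lia. Qed.

(** Up to defects the excess u - y is nondecreasing, as a running maximum; so u(r) - y(r) is at most
    u(t+1) - y(t+1), and v(t) <= y(t+1). *)
Lemma row_insert_gap r t : r <= t.+1 ->
  prefix_count V t + prefix_count U r <= prefix_count U t.+1 + prefix_count Y r.
Proof.
have [rV rU] := row_insert_row.
have [n] := ubnP (t.+1 - r); elim: n r => // n IH r rn rt.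
have := row_insert_shift t; have := row_insert_ge t.+1.
case: (row_insert_upper r) => [->|[s sr e]|[h1 h2 h3]]; try lia.
  by have := @row_insert_lower s t.+1; lia.
(* At a defect [r] both rows gain exactly one entry over the next two columns, so the excess is the
   same at [r.+2]. *)
have hY := noadj_nth (isrow_noadj rY) h2.
have hU : nth false U r = false.
  by apply/negP => /(noadj_nth (isrow_noadj rU)); rewrite h3.
have e1 : prefix_count Y r.+2 = (prefix_count Y r).+1 by rewrite !prefix_countS h2 hY; lia.
have e2 : prefix_count U r.+2 = (prefix_count U r).+1 by rewrite !prefix_countS h3 hU; lia.
(* For r >= t the index r + 2 is out of range: the bound x(t) <= u(t) of the defect settles r = t,
   and v(t) <= y(t+1) settles r = t + 1. *)
case: (ltngtP r t) => h; last first.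
- move: h e1 e2 h1 => -> e1 e2; have := row_insert_cnt t; have := prefix_countS U t; lia.
- by (have -> : r = t.+1 by lia); lia.
- have {}IH : prefix_count V t + prefix_count U r.+2 <= prefix_count U t.+1 + prefix_count Y r.+2.
    by apply: IH; lia.
  lia.
Qed.

(** The same monotonicity of the excess u - y, compared with its value at the right end. *)
Lemma row_insert_total r : prefix_count U r + weight Y <= weight U + prefix_count Y r.
Proof.
have [rV rU] := row_insert_row.
have hL : weight Y <= weight U by have := row_insert_ge L; rewrite !prefix_countL.
have [n] := ubnP (L - r); elim: n r => // n IH r rn.
case: (row_insert_upper r) => [->|[s sr e]|[h1 h2 h3]]; first lia.
  have := @row_insert_lower s (L + r); rewrite !(@prefix_countL _ (L + r)) //; lia.
have rL : r < L.
  by rewrite ltnNge; apply/negP => rL; move: h2; rewrite nth_default ?(isrow_size rY).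
have hY := noadj_nth (isrow_noadj rY) h2.
have hU : nth false U r = false.
  by apply/negP => /(noadj_nth (isrow_noadj rU)); rewrite h3.
have e1 : prefix_count Y r.+2 = (prefix_count Y r).+1 by rewrite !prefix_countS h2 hY; lia.
have e2 : prefix_count U r.+2 = (prefix_count U r).+1 by rewrite !prefix_countS h3 hU; lia.
have {}IH : prefix_count U r.+2 + weight Y <= weight U + prefix_count Y r.+2 by apply: IH; lia.
lia.
Qed.

End Op.

(** * Two successive rows of a tableau under insertion *)

Section ThreeRows.
Variables C X Y : bitrow.
Hypotheses (rC : isrow C) (rX : isrow X) (rY : isrow Y) (dCX : dyck_below C X).
Let V := (row_insert X Y).1.
Let U := (row_insert X Y).2.
Let U2 := (row_insert C V).2.

(** If the maximum for [U2] is c(s) - v(s+1), then c(s) <= x(s+1), and x(s+1) - v(s+1) = u(s+1) -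
    y(s+1) is at most the total excess, which is [weight X - weight V]. *)
Lemma next_insert_weight : weight U2 <= weight X.
Proof.
have [rV rU] := row_insert_row rX rY; have [_ rU2] := row_insert_row rC rV.
have := row_insert_upper rC rV L; rewrite -/V -/U2 !prefix_countL //.
have hV : weight V + weight U = weight X + weight Y.
  by have := row_insert_cnt rX rY L; rewrite -/U -/V !prefix_countL.
have := row_insert_ge rX rY L; rewrite -/U !prefix_countL // => hU.
case=> [->|[s sL e]|[_ h _]]; first lia.
  have := row_insert_total rX rY s.+1; have := row_insert_cnt rX rY s.+1.
  by move/dyck_belowP: dCX => /(_ s); rewrite -/U -/V; lia.
by move: h; rewrite nth_default // (isrow_size rV).
Qed.

Lemma next_insert_dyck_below : dyck_below U2 U.
Proof.
have [rV rU] := row_insert_row rX rY; have [_ rU2] := row_insert_row rC rV.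
apply/dyck_belowP => t; have [n] := ubnP (L - t); elim: n t => // n IH t tn.
case: (leqP L t) => tL.
  rewrite !prefix_countL //; last lia.
  by have := next_insert_weight; have [] := row_insert_weight rX rY; rewrite -/U; lia.
case: (row_insert_upper rC rV t) => [|[s sL]|[_ _]]; rewrite -/V -/U2.
- by move=> ->; have := dyck_belowP _ _ (row_insert_dom rX rY) t.
- have := @row_insert_gap _ _ rX rY s.+1 t; have := row_insert_cnt rX rY s.+1.
  by move/dyck_belowP: dCX => /(_ s); rewrite -/U -/V; lia.
(* At a defect [U2] contains column t + 1, while [U] gains at most one from t + 1 to t + 3: the
   bound at t + 2 gives the one at t. *)
- move=> h; have {}IH : prefix_count U2 t.+2 <= prefix_count U t.+3 by (apply: IH; lia).
  have := noadj_prefix_count t.+1 (isrow_noadj rU).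
  have := prefix_countS U2 t.+1; rewrite h; have := prefix_count_le U2 (leqnSn t); rewrite -/U; lia.
Qed.

End ThreeRows.

(** * Undoing the insertion of a row into a row *)

Section Unop.
Variables (V U : bitrow) (k : nat).
Hypotheses (rV : isrow V) (rU : isrow U) (dVU : dyck_below V U).
Hypotheses (kV : weight V <= k) (kU : k <= weight U).
Let q := weight U - k.
Let X := (row_uninsert q V U).1.
Let Y := (row_uninsert q V U).2.
Let m := mirror (zip V U).

Lemma row_uninsert_row : isrow X /\ isrow Y.
Proof.
have [v s e1 e2] := zip_valid rV rU.
have : valid (mirror (queue_scan q m)) by rewrite valid_mirror scan_valid // valid_mirror.
rewrite valid_unzip => /andP[nX nY].
by rewrite /isrow /X /Y /row_uninsert /= !size_map size_mirror size_scan size_mirror s eqxx.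
Qed.

Let c1m t : fst_count t m + prefix_count U (L - t) = weight U.
Proof.
have [v s e1 e2] := zip_valid rV rU.
by have := fst_count_mirror t (zip V U); rewrite s e2.
Qed.

Let c2m t : snd_count t m + prefix_count V (L - t) = weight V.
Proof.
have [v s e1 e2] := zip_valid rV rU.
by have := snd_count_mirror t (zip V U); rewrite s e1.
Qed.

Let c2s t : snd_count t (queue_scan q m) + prefix_count X (L - t) = weight X.
Proof.
have [v s e1 e2] := zip_valid rV rU.
have := snd_count_mirror t (mirror (queue_scan q m)).
by rewrite mirrorK size_mirror size_scan size_mirror s.
Qed.

(** In the max-plus formula for the reversed word the term s = L equals [weight U - q], which is
    [k]. No other term exceeds it, by [dVU], nor does the term 0, by [kV]. *)
Lemma row_uninsert_weight : weight X = k.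
Proof.
have [v s e1 e2] := zip_valid rV rU.
have vm : valid m by rewrite valid_mirror.
have := c2s L; rewrite subnn prefix_count0 addn0 => <-.
have sm : size m = L by rewrite size_mirror.
have := @scan_lower q m L L; rewrite leqnn => /(_ isT).
have := c1m L; have := c2m L; have := c2m L.+1.
have -> : L - L.+1 = 0 by lia.
rewrite subnn !prefix_count0 !addn0 => -> -> ->.
case: (scan_upper q L vm) => [-> h|[t tL e] h|[_ h _]]; last by rewrite nth_default ?sm in h.
  by have := c2m L; rewrite subnn prefix_count0; rewrite /q in h *; lia.
have := c1m t; have := c2m t.+1; have := c2m L; rewrite subnn prefix_count0.
case: (ltngtP t L) tL e => // [tL|->] _ e.
  have -> : L - t = (L - t.+1).+1 by lia.
  move/dyck_belowP: dVU => /(_ (L - t.+1)); rewrite /q in h e *; lia.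
have -> : L - L.+1 = 0 by lia.
rewrite subnn !prefix_count0; rewrite /q in h e *; lia.
Qed.

(** The weight of [X] forces the reversed queue to end empty, and running it forward from an empty
    queue is [row_insert]. *)
Lemma row_uninsertK : row_insert X Y = (V, U).
Proof.
have [v s e1 e2] := zip_valid rV rU.
have vm : valid m by rewrite valid_mirror.
have := @scan_fin q m L; rewrite size_mirror s leqnn => /(_ isT).
have := c2s L; have := c1m L; rewrite subnn !prefix_count0 !addn0 row_uninsert_weight => -> ->.
move=> h; have f0 : final_queue q m = 0 by rewrite /q in h *; lia.
have [] := scanK q vm; rewrite f0 => /(congr1 mirror); rewrite !mirrorK => h1 _.
by rewrite /row_insert /X /Y /row_uninsert /= zip_unzip h1 ?mirrorK e1 e2.
Qed.

(** [scan_upper] for the reversed word: up to a defect, x(t) - v(t) is [k - weight V] or some u(s) -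
    v(s-1) with s >= t. Column L - t + 1 of the reversed word is column t - 2 here. *)
Lemma row_uninsert_upper t : t <= L ->
  [\/ prefix_count X t + weight V = k + prefix_count V t,
   exists s, t <= s /\
     prefix_count X t + prefix_count V s.-1 = prefix_count V t + prefix_count U s |
   [/\ 1 < t & nth false X t.-2]].
Proof.
move=> tL.
have [v s e1 e2] := zip_valid rV rU.
have vm : valid m by rewrite valid_mirror.
have := c2s (L - t); have := c2m (L - t); rewrite row_uninsert_weight subKn // => hV hX.
case: (scan_upper q (L - t) vm) => [e|[r rt e]|[_ _ h]].
- by constructor 1; lia.
- constructor 2; exists (L - r); split; first lia.
  have qE : q + k = weight U by rewrite /q subnK.
  have := c1m r; have := c2m r.+1; rewrite subnS; lia.
- have {h} hX' : prefix_count X (L - (L - t).+1) = (prefix_count X (L - (L - t).+2)).+1.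
    have := c2s (L - t).+1; have := c2s (L - t).+2.
    by rewrite -!prefix_count_unzip2 [prefix_count _ (L - t).+2]prefix_countS nth_unzip2 h; lia.
  constructor 3; case: t tL hX' {hV hX} => [|[|t]] tL.
  + move=> hX; exfalso; move: hX; rewrite (_ : L - (L - 0).+1 = L - (L - 0).+2); lia.
  + move=> hX; exfalso; move: hX; rewrite (_ : L - (L - 1).+1 = L - (L - 1).+2); lia.
  have -> : L - (L - t.+2).+2 = t by lia.
  have -> : L - (L - t.+2).+1 = t.+1 by lia.
  by rewrite prefix_countS => hX; split => //=; move: hX; case: nth => //=; lia.
Qed.

End Unop.

Section ThreeRowsInverse.
Variables (C V U : bitrow) (k : nat).
Hypotheses (rC : isrow C) (rV : isrow V) (rU : isrow U).
Let U2 := (row_insert C V).2.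
Hypotheses (dU : dyck_below U2 U) (U2k : weight U2 <= k) (kU : k <= weight U).
Let X := (row_uninsert (weight U - k) V U).1.

(** Whichever value [row_uninsert_upper] gives for x(t+1), it is at least c(t), by the lower bound
    for inserting [V] into [C] and the bounds on [U2]. *)
Lemma next_delete_dyck_below : dyck_below C X.
Proof.
have lV t : prefix_count V t <= prefix_count U2 t by exact: (row_insert_ge rC rV).
have dV : dyck_below V U.
  by apply/dyck_belowP => t; apply: leq_trans (lV t) (dyck_belowP _ _ dU t).
have [_ rU2] : isrow _ /\ isrow U2 := row_insert_row rC rV.
have VU2 : weight V <= weight U2 by have := lV L; rewrite !prefix_countL.
have VK : weight V <= k by apply: leq_trans U2k.
have [rX _] : isrow X /\ isrow _ := row_uninsert_row k rV rU.
have wX : weight X = k by exact: row_uninsert_weight.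
have [wC _] : weight C <= weight U2 /\ _ := row_insert_weight rC rV.
have low s t : s <= t ->
  prefix_count C s + prefix_count V t <= prefix_count U2 t + prefix_count V s.+1.
  exact: row_insert_lower.
apply/dyck_belowP => t; have [n] := ubnP t; elim: n t => // n IH t tn.
case: (leqP L t) => tL; first by rewrite !prefix_countL //; lia.
have := @row_uninsert_upper V U k rV rU dV VK kU t.+1 tL; rewrite -/X; case=> [e|[s [ts e]]|[t1 h]].
- have := low t L (ltnW tL); rewrite !(@prefix_countL _ L) //; lia.
- have := low t s.-1; have := dyck_belowP _ _ dU s.-1; rewrite prednK; lia.
(* At a defect [X] contains column t - 1, and [C] gains at most one entry over two columns: induct
   from t - 2. *)
- case: t t1 h tn {tL} => [|[|t]] // _ /= h tn.
    by rewrite !prefix_countS !prefix_count0 h; case: nth; case: nth.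
  have {}IH : prefix_count C t <= prefix_count X t.+1 by apply: IH; lia.
  have := noadj_prefix_count t (isrow_noadj rC);
    rewrite (prefix_countS X t.+2) (prefix_countS X t.+1) h; lia.
Qed.

End ThreeRowsInverse.
End Rows.

(** * Insertion of a row into a tableau *)

(* Otherwise [/=] unfolds them under projections. *)
Opaque row_insert row_uninsert.

(* Empty rows are kept, so that each insertion adds exactly one row. *)
Fixpoint tab_insert (P : seq bitrow) (F : bitrow) : seq bitrow :=
  if P is T :: P' then (row_insert T F).2 :: tab_insert P' (row_insert T F).1 else [:: F].

(** Works from the bottom row up. [mu] is the shape before the insertion and yields the queue length
    for each row. *)
Fixpoint tab_delete (mu : seq nat) (P : seq bitrow) : seq bitrow * bitrow :=
  match mu, P with
  | k :: mu', U :: P' =>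
      let PV := tab_delete mu' P' in
      let XY := row_uninsert (weight U - k) PV.2 U in
      (XY.1 :: PV.1, XY.2)
  | _, P => ([::], head [::] P)
  end.

(** The skew shape la/mu is a horizontal strip, where [la] has exactly one row more and rows may be
    empty. *)
Fixpoint interlaces (mu la : seq nat) : bool :=
  match mu, la with
  | [::], [:: _] => true
  | m :: mu', l :: la' => (head 0 la' <= m <= l) && interlaces mu' la'
  | _, _ => false
  end.

Definition dyck_above (T B : bitrow) := dyck_below B T.

Lemma size_ins P F : size (tab_insert P F) = (size P).+1.
Proof. by elim: P F => //= T P IH F; rewrite IH. Qed.

Section Tab.
Variable L : nat.
Local Notation isrow := (isrow L).

Lemma ins_tab P F : all isrow P -> sorted dyck_above P -> isrow F ->
  [/\ all isrow (tab_insert P F), sorted dyck_above (tab_insert P F)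
    & interlaces (map weight P) (map weight (tab_insert P F))].
Proof.
elim: P F => [|T P IH] F; first by move=> _ _ /= ->.
move=> /= /andP[rT rP] sP rF.
have [rV rU] := row_insert_row rT rF.
have [r1 r2 r3] := IH _ rP (path_sorted sP) rV.
have [wU _] := row_insert_weight rT rF.
rewrite rU r1 r3 wU /= andbT andbT.
(* Only the two top rows remain: the second is the bumped row itself, or the result of inserting it
   into the next row. *)
suff [h1 h2] : dyck_above (row_insert T F).2 (head [::] (tab_insert P (row_insert T F).1)) /\
    head 0 (map weight (tab_insert P (row_insert T F).1)) <= weight T.
  split=> //; first by case: tab_insert h1 r2 => //= H P' -> ->.
case: P sP rP {IH r1 r2 r3} => [_ _|C P] /=.
  split; first exact: row_insert_dom rT rF.
  by have := row_insert_le rT rF L; rewrite !(@prefix_countL L).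
move=> /andP[dC _] /andP[rC _].
by split; [apply: (next_insert_dyck_below (L := L)) | apply: (next_insert_weight (L := L))].
Qed.

Lemma del_ins P F : all isrow P -> isrow F -> tab_delete (map weight P) (tab_insert P F) = (P, F).
Proof.
elim: P F => //= T P IH F /andP[rT rP] rF.
have [rV rU] := row_insert_row rT rF.
by rewrite IH //= (row_insertK rT rF).
Qed.

Lemma del_tab mu P : all isrow P -> sorted dyck_above P -> interlaces mu (map weight P) ->
  let PF := tab_delete mu P in
  [/\ all isrow PF.1, isrow PF.2, sorted dyck_above PF.1, map weight PF.1 = mu
    & tab_insert PF.1 PF.2 = P].
Proof.
(* Strengthened so that the ejected row, having no larger counts than the top row, still lies Dyck
   below the row above. *)
suff H : all isrow P -> sorted dyck_above P -> interlaces mu (map weight P) ->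
  let PF := tab_delete mu P in
  [/\ all isrow PF.1, isrow PF.2, sorted dyck_above PF.1, map weight PF.1 = mu
    & tab_insert PF.1 PF.2 = P]
  /\ forall t, prefix_count PF.2 t <= prefix_count (head [::] P) t.
  by move=> r s i; case: (H r s i).
elim: mu P => [|k mu IH] [|U P] //=.
  by case: P => // /andP[rU _] _ _.
move=> /andP[rU rP] sP /andP[/andP[h1 h2] hi].
case: (tab_delete mu P) (IH P rP (path_sorted sP) hi) => {IH} P1 V /= [[r1 rV s1 w1 insE] lV].
have [dH rH] : dyck_below (head [::] P) U /\ isrow (head [::] P).
  by case: P {s1 r1 rV insE lV h1} rP sP hi => [|H P] /=;
    [by case: (mu) | move=> /andP[-> _] /andP[]].
have dV : dyck_below V U by apply/dyck_belowP => t; apply: leq_trans (lV t) (dyck_belowP _ _ dH t).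
have Vk : weight V <= k.
  have := lV L; rewrite !(@prefix_countL L) //; move: h1; case: (P) hi => [|H P'] //=;
    first by case: (mu).
  by move=> _; lia.
have [rX rY] := row_uninsert_row k rV rU.
have wX := row_uninsert_weight rV rU dV Vk h2.
have row_insertE := row_uninsertK rV rU dV Vk h2.
rewrite rX r1 rY w1 wX row_insertE /= insE; split; last first.
  by move=> t; have := row_insert_ge rX rY t; rewrite row_insertE.
split=> //.
case EP: P1 s1 => [|C P2] //= ->; rewrite andbT.
move: r1 insE dH h1 => /=; rewrite EP => /= /andP[rC _] <- /= dH h1.
exact: (next_delete_dyck_below (L := L)).
Qed.
End Tab.

(** * From bit rows to integer rows *)

Lemma di_nil : di [::] = 0.
Proof. by apply: eq_card0 => -[[]]. Qed.

Lemma di_cons (x : int) s : di (x :: s) = count (fun y => x == (y + 1)%R) s + di s.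
Proof.
have E z : di z = \sum_(i < size z) \sum_(j < size z) ((i < j) && (z`_i == z`_j + 1)%R).
  rewrite /di cardsE -sum1_card pair_big /= big_mkcond /=.
  by apply: eq_bigr => -[i j] _; rewrite unfold_in /=; case: (_ && _).
rewrite !E /= big_ord_recl big_ord_recl ltnn add0n; congr (_ + _).
  rewrite -sum1_count (big_nth 0%R) big_mkord [RHS]big_mkcond.
  by apply: eq_bigr => i _ /=; case: (_ == _).
by apply: eq_bigr => i _; rewrite big_ord_recl ltn0 add0n.
Qed.

Definition cross (s t : seq int) := \sum_(x <- s) count (fun y => x == (y + 1)%R) t.

Lemma di_cat s t : di (s ++ t) = di s + di t + cross s t.
Proof.
elim: s => [|x s IH] /=; first by rewrite /cross big_nil addn0 di_nil.
by rewrite !di_cons IH /cross big_cons count_cat; lia.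
Qed.

(** The two invariants of insertion. Concatenation respects the relation, because [cross] depends
    only on the multisets. *)
Definition eqdi (s t : seq int) := perm_eq s t /\ di s = di t.

Lemma cross_perm s s' t t' : perm_eq s s' -> perm_eq t t' -> cross s t = cross s' t'.
Proof.
move=> ps /permP pt; rewrite /cross (perm_big _ ps) /=.
by apply: eq_bigr => x _; rewrite pt.
Qed.

Lemma eqdi_refl s : eqdi s s. Proof. by split. Qed.

Lemma eqdi_trans s t u : eqdi s t -> eqdi t u -> eqdi s u.
Proof. by move=> [p1 d1] [p2 d2]; split; [apply: perm_trans p1 p2 | rewrite d1]. Qed.

Lemma eqdi_cat s s' t t' : eqdi s s' -> eqdi t t' -> eqdi (s ++ t) (s' ++ t').
Proof.
move=> [ps ds] [pt dt]; split; first exact: perm_cat.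
by rewrite !di_cat ds dt (cross_perm ps pt).
Qed.

Fixpoint ints (lo : int) (b : bitrow) : seq int :=
  if b is c :: b' then nseq c lo ++ ints (lo + 1)%R b' else [::].

Lemma size_ints lo b : size (ints lo b) = weight b.
Proof. by elim: b lo => //= c b IH lo; rewrite size_cat size_nseq IH. Qed.

Lemma ints_ge lo b : all (fun x => lo <= x)%R (ints lo b).
Proof.
elim: b lo => //= c b IH lo; rewrite all_cat all_nseq lexx orbT /=.
by apply: sub_all (IH _) => x; lia.
Qed.

Lemma count_ints_lt lo b t : count (fun x => x < lo + t%:Z)%R (ints lo b) = prefix_count b t.
Proof.
elim: b lo t => [|c b IH] lo [|t] //.
  apply/eqP; rewrite prefix_count0 -leqn0 leqNgt -has_count -all_predC.
  by apply: sub_all (ints_ge lo (c :: b)) => x /=; lia.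
rewrite [ints _ _]/= count_cat count_nseq /prefix_count /= -/(prefix_count b t) -(IH (lo + 1)%R)
  (_ : (lo < _)%R); last lia.
by rewrite mul1n; congr (_ + _); apply: eq_count => x; lia.
Qed.

Lemma ints_sorted lo b : sorted (fun x y : int => x < y)%R (ints lo b).
Proof.
elim: b lo => //= -[] b IH lo //=; rewrite path_sortedE; last exact: lt_trans.
by rewrite IH andbT; apply: sub_all (ints_ge _ _) => x; lia.
Qed.

Lemma dual_dyck_ints lo b : dual_dyck (ints lo b) = noadj b.
Proof.
elim: b lo => [|c b IH] lo //.
have E : noadj (c :: b) = ~~ (c && head false b) && noadj b.
  by rewrite /noadj; case: b {IH} => [|d b] /=; rewrite ?andbF.
rewrite E -(IH (lo + 1)%R) /dual_dyck.
case: c {E} => //=.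
case: b {IH} => [|[] b] //=; first by have -> : (lo + 2 <= lo + 1)%R = false by lia.
have := ints_ge (lo + 1 + 1)%R b; case: ints => //= x s /andP[h _].
by have -> : (lo + 2 <= x)%R by lia.
Qed.

Lemma di_ints lo b : di (ints lo b) = 0.
Proof.
elim: b lo => [|c b IH] lo /=; first exact: di_nil.
case: c => //=; rewrite di_cons IH addn0; apply/eqP; rewrite -leqn0 leqNgt -has_count -all_predC.
by apply: sub_all (ints_ge _ _) => x /=; lia.
Qed.

Lemma cross_ints lo w : cross (ints lo (unzip1 w)) (ints lo (unzip2 w)) = yx_count w.
Proof.
elim: w lo => [|[x y] w IH] lo /=; first by rewrite /cross big_nil.
rewrite -(IH (lo + 1)%R) /cross big_cat /=.
have -> : \sum_(i <- nseq x lo)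
    count (fun z => i == (z + 1)%R) (nseq y lo ++ ints (lo + 1)%R (unzip2 w)) = 0.
  rewrite big_nseq; apply/eqP; case: x => //=; rewrite addn0 count_cat count_nseq.
  have -> : (lo == lo + 1)%R = false by lia.
  rewrite -leqn0 leqNgt -has_count -all_predC.
  by apply: sub_all (ints_ge _ _) => x /=; lia.
rewrite add0n; under eq_bigr do rewrite count_cat count_nseq; rewrite big_split /=; congr (_ + _).
case: y => /=; last by rewrite big1 // => i _; rewrite muln0.
under eq_bigr do rewrite muln1; case: w {IH} => [|[[] y] w] /=; first by rewrite big_nil.
  rewrite big_cons eqxx; congr (_ + _).
  rewrite big_seq big1 // => i /(allP (ints_ge _ _)) h.
  by have -> : (i == lo + 1)%R = false by lia.
rewrite big_seq big1 // => i /(allP (ints_ge _ _)) h.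
by have -> : (i == lo + 1)%R = false by lia.
Qed.

Lemma perm_scan lo q w : perm_eq (ints lo (unzip1 w) ++ ints lo (unzip2 w))
  (ints lo (unzip1 (queue_scan q w)) ++ ints lo (unzip2 (queue_scan q w))).
Proof.
apply/permP => p; rewrite !count_cat.
move: q w lo; apply: scan_ind => // [q b w|q w|q w|w|w hw] IH lo;
  rewrite ?scan_bb ?(scan_xe hw) /=.
- by rewrite !count_cat; have /= := IH (lo + 1)%R; lia.
- by have /= := IH (lo + 1)%R; lia.
- by have /= := IH (lo + 1)%R; lia.
- by have /= := IH (lo + 1 + 1)%R; case: ifP => /= _; lia.
- by have /= := IH (lo + 1)%R; lia.
Qed.

Lemma eqdi_op L lo X Y : isrow L X -> isrow L Y ->
  eqdi (ints lo X ++ ints lo Y) (ints lo (row_insert X Y).1 ++ ints lo (row_insert X Y).2).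
Proof.
move=> rX rY; have [v s e1 e2] := zip_valid rX rY.
rewrite row_insertE; split; first by have := perm_scan lo 0 (zip X Y); rewrite e1 e2.
by rewrite !di_cat !di_ints cross_ints scan_yx // -(cross_ints lo) e1 e2.
Qed.

Definition reading lo (P : seq bitrow) := flatten [seq ints lo T | T <- rev P].

Lemma reading_cons lo T P : reading lo (T :: P) = reading lo P ++ ints lo T.
Proof. by rewrite /reading rev_cons map_rcons flatten_rcons. Qed.

Lemma eqdi_ins L lo P F : all (isrow L) P -> isrow L F ->
  eqdi (reading lo P ++ ints lo F) (reading lo (tab_insert P F)).
Proof.
elim: P F => [|T P IH] F; first by move=> _ _; rewrite reading_cons; apply: eqdi_refl.
move=> /= /andP[rT rP] rF; have [rV rU] := row_insert_row rT rF.
rewrite !reading_cons -catA; apply: eqdi_trans (eqdi_cat (IH _ rP rV) (eqdi_refl _)).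
by rewrite -catA; apply: eqdi_cat (eqdi_refl _) (eqdi_op _ rT rF).
Qed.

Definition bits (lo : int) L (s : seq int) : bitrow := mkseq (fun i => (lo + i%:Z)%R \in s) L.

Lemma nth_ints lo b i : nth false b i = ((lo + i%:Z)%R \in ints lo b).
Proof.
elim: b lo i => [|c b IH] lo [|i] //=.
  rewrite mem_cat mem_nseq addr0 eqxx andbT; case: c => //=.
  by apply/esym/negP => /(allP (ints_ge _ _)); lia.
rewrite mem_cat mem_nseq (IH (lo + 1)%R) (_ : (_ == lo)%R = false); last lia.
by rewrite andbF /= intS addrA.
Qed.

Lemma intsK lo b : bits lo (size b) (ints lo b) = b.
Proof.
apply: (@eq_from_nth _ false); rewrite size_mkseq // => i ib.
by rewrite nth_mkseq // -nth_ints.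
Qed.

Lemma ints_lt lo b : all (fun x => x < lo + (size b)%:Z)%R (ints lo b).
Proof.
elim: b lo => //= c b IH lo; rewrite all_cat all_nseq; apply/andP; split; first by lia.
by apply: sub_all (IH _) => x; lia.
Qed.

Definition in_window lo L (x : int) := ((lo <= x) && (x < lo + L%:Z))%R.

Lemma dual_dyck_sorted s : dual_dyck s -> sorted (fun x y : int => x < y)%R s.
Proof. by apply: sub_sorted => x y; lia. Qed.

Lemma bitsK lo L s : dual_dyck s -> all (in_window lo L) s -> ints lo (bits lo L s) = s.
Proof.
move=> ds ws; apply: (@irr_sorted_eq _ (fun x y : int => x < y)%R).
- exact: lt_trans.
- exact: ltxx.
- exact: ints_sorted.
- exact: dual_dyck_sorted.
move=> x; have := ints_lt lo (bits lo L s); have := ints_ge lo (bits lo L s).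
rewrite size_mkseq => /allP h1 /allP h2.
case: (boolP (in_window lo L x)) => [/andP[h3 h4]|wx].
  have -> : x = (lo + `|x - lo|%N%:Z)%R by lia.
  by rewrite -nth_ints nth_mkseq //; lia.
apply/idP/idP => [xi|/(allP ws)]; last by rewrite (negbTE wx).
by move: wx; rewrite /in_window h1 // h2.
Qed.

Lemma bits_row lo L s : dual_dyck s -> all (in_window lo L) s -> isrow L (bits lo L s).
Proof. by move=> ds ws; rewrite /isrow size_mkseq eqxx -(dual_dyck_ints lo) bitsK. Qed.

(** * Column conditions as inequalities between counts *)

Section Columns.
Variables (T : Type) (x0 : T).

(** Merges partition shape and column condition into one relation on adjacent rows, so that tableaux
    become sorted lists; see [tabE]. *)
Definition colrel (R : rel T) (r s : seq T) :=
  (size s <= size r) && all (fun ab => R ab.1 ab.2) (zip r s).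

Lemma colrelP (R : rel T) r s :
  reflect (forall p, p < size s -> p < size r /\ R (nth x0 r p) (nth x0 s p)) (colrel R r s).
Proof.
apply: (iffP andP) => [[sz /(all_nthP (x0, x0)) h] p ps|h].
  have pr : p < size r by lia.
  by split=> //; have := h p; rewrite size_zip nth_zip_cond size_zip (minn_idPr sz) ps => /(_ isT).
have sz : size s <= size r.
  by case: (size s) h => // n h; have [] := h n (ltnSn n).
split=> //; apply/(all_nthP (x0, x0)) => p; rewrite size_zip (minn_idPr sz) => ps.
by rewrite nth_zip_cond size_zip (minn_idPr sz) ps /=; case: (h p ps).
Qed.

Lemma colrel_nil (R : rel T) r : colrel R r [::].
Proof. by case: r. Qed.

(** In a sorted row the entries satisfying a downward closed predicate form a prefix, whose length
    is the count. *)
Lemma sorted_count (r : rel T) (P : pred T) s p : transitive r ->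
  (forall x y, r x y -> P y -> P x) -> sorted r s ->
  (p < count P s) = (p < size s) && P (nth x0 s p).
Proof.
move=> tr rP; elim: s p => //= x s IH p ps.
have {}IH := IH^~ (path_sorted ps).
case Px: (P x); first by case: p => [|p]; rewrite add1n ?ltnS ?IH /= ?Px.
have -> : count P s = 0.
  apply/eqP; rewrite -leqn0 leqNgt -has_count -all_predC.
  by move: ps; rewrite path_sortedE // => /andP[+ _]; apply: sub_all => y /rP /=; rewrite Px;
    case: (P y) => // /(_ isT).
case: p => [|p] /=; rewrite ?Px ?ltn0 //; apply/esym/andP => -[].
rewrite ltnS => ps' Pn; move: ps; rewrite path_sortedE // => /andP[/(all_nthP x0) h _].
by have := rP _ _ (h _ ps') Pn; rewrite Px.
Qed.

End Columns.

Lemma leq_of_lt m n : (forall p, p < m -> p < n) -> m <= n.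
Proof. by case: m => // m; apply. Qed.

Lemma colrel_dyck_above lo T B :
  colrel (fun a b : int => a <= b + 1)%R (ints lo T) (ints lo B) = dyck_above T B.
Proof.
have H b t p : (p < prefix_count b t) =
    (p < size (ints lo b)) && (@nth int 0 (ints lo b) p < lo + t%:Z)%R.
  rewrite -(count_ints_lt lo); apply: (@sorted_count _ 0%R (fun x y : int => x < y)%R).
  - exact: lt_trans.
  - by move=> x y; lia.
  - exact: ints_sorted.
apply/(@colrelP int 0%R)/dyck_belowP => [h t|h p pB].
  apply: leq_of_lt => p; rewrite !H => /andP[pB lB].
  by have [-> h2] := h p pB; lia.
have /(allP (ints_ge _ _)) /= hge : @nth int 0%R (ints lo B) p \in ints lo B by rewrite mem_nth.
set b : int := @nth int 0%R (ints lo B) p in hge *.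
(* The threshold lies just above the entry [b], so that column [p] is counted in [B] and hence in
   [T]. *)
have hq : (b < lo + (`|b - lo|%N.+1)%:Z)%R by lia.
have := H B `|b - lo|%N.+1 p; rewrite pB -/b hq /=.
move=> /leq_trans /(_ (h _)); rewrite H => /andP[-> h2]; split=> //; lia.
Qed.

(** * Semistandard tableaux as chains of shapes *)

Lemma colrel_ltnP r s : sorted leq r -> sorted leq s ->
  reflect (forall a, count (fun x => x <= a) s <= count (fun x => x < a) r) (colrel ltn r s).
Proof.
move=> sr ss.
have Hs a p : (p < count (fun x => x <= a) s) = (p < size s) && (nth 0 s p <= a).
  by apply: (@sorted_count _ 0 leq) => // [|x y xy ya]; [apply: leq_trans | apply: leq_trans ya].
have Hr a p : (p < count (fun x => x < a) r) = (p < size r) && (nth 0 r p < a).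
  by apply: (@sorted_count _ 0 leq) => // [|x y xy ya];
    [apply: leq_trans | apply: leq_ltn_trans ya].
apply: (iffP (colrelP 0 _ _ _)) => h.
  move=> a; apply: leq_of_lt => p; rewrite Hs Hr => /andP[ps pa].
  by have [-> h2] := h p ps; apply: leq_trans pa.
move=> p ps; have := Hs (nth 0 s p) p; rewrite ps leqnn => /leq_trans /(_ (h _)).
by rewrite Hr => /andP[].
Qed.

Definition letters n (Q : seq (seq nat)) := all (all (fun a => a < n)) Q.
Definition below n := filter (fun a : nat => a < n).
Definition growrow n (r : seq nat) l := r ++ nseq (l - size r) n.
(** Fills the strip between the shape of [Q] and [la] with the letter [n]; the empty row added first
    matches the row that each insertion adds. *)
Definition grow n Q la := [seq growrow n rl.1 rl.2 | rl <- zip (rcons Q [::]) la].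
Definition shrink n (Q : seq (seq nat)) := take n [seq below n r | r <- Q].

Lemma size_growrow n r l : size r <= l -> size (growrow n r l) = l.
Proof. by move=> h; rewrite size_cat size_nseq subnKC. Qed.

Lemma below_growrow n r l : all (fun a => a < n) r -> below n (growrow n r l) = r.
Proof.
move=> /all_filterP h; rewrite /below filter_cat h; apply/eqP.
by rewrite -[X in _ == X]cats0 eqseq_cat // eqxx -size_eq0 size_filter count_nseq ltnn.
Qed.

Lemma sorted_growrow n r l : all (fun a => a < n) r -> sorted leq r -> sorted leq (growrow n r l).
Proof.
move=> rn sr; rewrite /growrow; have trL : transitive leq := leq_trans.
rewrite sorted_pairwise // pairwise_cat -!sorted_pairwise // sr /=; apply/andP; split.
  apply/allrelP => x y /(allP rn) xn; rewrite mem_nseq => /andP[_ /eqP->]; exact: ltnW.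
by elim: (l - size r) => //= -[|k] //=; rewrite leqnn.
Qed.

Lemma letters_growrow n r l : all (fun a => a < n) r -> all (fun a => a < n.+1) (growrow n r l).
Proof.
move=> rn; rewrite all_cat all_nseq ltnSn orbT andbT.
by apply: sub_all rn => a /ltnW.
Qed.

Lemma count_growrow (p : pred nat) n r l : count p (growrow n r l) = count p r + p n * (l - size r).
Proof. by rewrite count_cat count_nseq. Qed.

Lemma growrow_below n r : sorted leq r -> all (fun a => a < n.+1) r ->
  growrow n (below n r) (size r) = r.
Proof.
elim: r => //= a r IH pr /andP[an rn].
have {}IH := IH (path_sorted pr) rn; rewrite /growrow /below /=.
case: ltnP => ha /=; first by rewrite subSS -[in RHS]IH.
have ar : all (fun b => n <= b) r.
  by move: pr; rewrite path_sortedE; [move=> /andP[+ _];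
    apply: sub_all => b /(leq_trans ha) | exact: leq_trans].
have e : [seq b <- r | b < n] = [::].
  by apply/eqP; rewrite -size_eq0 size_filter -leqn0 leqNgt -has_count -all_predC;
    apply: sub_all ar => b /=; lia.
by move: IH; rewrite /growrow /below e /= subn0 => ->; congr (_ :: _); lia.
Qed.

(** As k <= size r, the letters [n] added to the lower row stand under old entries of the upper row,
    which are smaller. *)
Lemma colrel_growrow n r s l k : all (fun a => a < n) r -> all (fun a => a < n) s ->
  sorted leq r -> sorted leq s -> colrel ltn r s -> size s <= k -> k <= size r -> size r <= l ->
  colrel ltn (growrow n r l) (growrow n s k).
Proof.
move=> rn sn sr ss /(colrel_ltnP sr ss) h h1 h2 h3.
apply/colrel_ltnP; rewrite ?sorted_growrow // => a; rewrite !count_growrow.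
case: (ltnP a n) => an; first by rewrite mul0n addn0; apply: leq_trans (h a) (leq_addr _ _).
have -> : count (fun x => x < a) r = size r by apply/eqP; rewrite -all_count;
  apply: sub_all rn => x; lia.
have -> : count (fun x => x <= a) s = size s by apply/eqP; rewrite -all_count;
  apply: sub_all sn => x; lia.
by case: (n < a); lia.
Qed.

Lemma growP n Q la : letters n Q -> all (sorted leq) Q -> sorted (colrel ltn) Q ->
  interlaces [seq size r | r <- Q] la ->
  [/\ letters n.+1 (grow n Q la), all (sorted leq) (grow n Q la),
      sorted (colrel ltn) (grow n Q la), [seq size r | r <- grow n Q la] = la
    & [seq below n r | r <- grow n Q la] = rcons Q [::]].
Proof.
elim: Q la => [|r Q IH] [|l la] //=.
  case: la => // _ _ _ _; rewrite /grow /= (@size_growrow _ [::]) // below_growrow //.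
  by rewrite sorted_growrow // letters_growrow.
move=> /andP[rn Qn] /andP[sr sQ] pQ /andP[/andP[h1 h2] hi].
have [g1 g2 g3 g4 g5] := IH la Qn sQ (path_sorted pQ) hi.
rewrite /grow /= -/(grow n Q la) letters_growrow // sorted_growrow // size_growrow //
  below_growrow //.
rewrite g1 g2 g4 g5; split=> //.
case: Q la {IH g1 g2 g4 g5} hi h1 pQ Qn sQ g3 => [|s Q] [|k la] //=.
  case: la => // _ h1 _ _ _ _; rewrite andbT; apply: colrel_growrow => //.
  exact: colrel_nil.
move=> /andP[/andP[_ k2] _] h1 /andP[rs _] /andP[sn _] /andP[ss _].
by rewrite /grow /= => ->; rewrite andbT; apply: colrel_growrow.
Qed.

Lemma count_grow i n Q la : interlaces [seq size r | r <- Q] la ->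
  count_mem i (flatten (grow n Q la)) + (i == n) * sumn [seq size r | r <- Q] =
  count_mem i (flatten Q) + (i == n) * sumn la.
Proof.
elim: Q la => [|r Q IH] [|l la] //=.
  case: la => // _; rewrite /grow /= cats0 count_growrow /= eq_sym; case: eqP => _; lia.
move=> /andP[/andP[_ h2] hi]; have := IH la hi.
rewrite /grow /= -/(grow n Q la) !count_cat count_nseq /= (eq_sym n); case: eqP => _; lia.
Qed.

(** Strict columns raise the lower bound by one per row. Hence the last of n + 1 rows has no letter
    below n, and the largest letter bounds the number of rows. *)
Lemma last_ge k r Q : sorted leq r -> all (sorted leq) Q -> all (fun a => k <= a) r ->
  path (colrel ltn) r Q -> all (fun a => k + size Q <= a) (last r Q).
Proof.
elim: Q k r => [|s Q IH] k r /=; first by rewrite addn0.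
move=> sr /andP[ss sQ] rk /andP[/(colrel_ltnP sr ss) h pQ].
rewrite addnS -addSn; apply: IH => //.
have : count (fun x => x <= k) s = 0.
  apply/eqP; rewrite -leqn0; apply: leq_trans (h k) _.
  rewrite leqNgt -has_count -all_predC; apply: sub_all rk => x /=; lia.
by move=> /eqP; rewrite -leqn0 leqNgt -has_count -all_predC; apply: sub_all => x /=; lia.
Qed.

(** Entries of the lower row are at most [n], so those above them are less than [n] and survive the
    removal; this gives the interlacing. *)
Lemma colrel_below n r s : sorted leq r -> sorted leq s ->
  all (fun a => a < n.+1) s -> colrel ltn r s ->
  colrel ltn (below n r) (below n s) /\ size s <= size (below n r).
Proof.
move=> sr ss sn /(colrel_ltnP sr ss) h.
have trL : transitive leq := leq_trans.
split; last first.
  rewrite size_filter; apply: leq_trans (h n).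
  by rewrite (_ : count _ _ = size s) //; apply/eqP; rewrite -all_count.
apply/colrel_ltnP; rewrite ?sorted_filter // => a; rewrite !count_filter.
case: (ltnP a n) => an.
  apply: (@leq_trans (count (fun x => x <= a) s)); first by apply: sub_count => x /andP[].
  by apply: leq_trans (h a) _; apply: sub_count => x /=; lia.
apply: (@leq_trans (count (fun x => x <= n) s)); first by apply: sub_count => x /=; lia.
by apply: leq_trans (h n) _; apply: sub_count => x /=; lia.
Qed.

Lemma shrink_aux n r Q : let Q' := r :: Q in let Q1 := take (size Q) [seq below n r | r <- Q'] in
  letters n.+1 Q' -> all (sorted leq) Q' -> sorted (colrel ltn) Q' -> below n (last r Q) = [::] ->
  [/\ letters n Q1, all (sorted leq) Q1, sorted (colrel ltn) Q1,
      interlaces [seq size r | r <- Q1] [seq size r | r <- Q']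
    & grow n Q1 [seq size r | r <- Q'] = Q'].
Proof.
elim: Q r => [|s Q IH] r /=.
  rewrite !andbT => rn sr _ e; split=> //.
  by rewrite /grow /= -[in RHS](growrow_below sr rn) e.
move=> /and3P[rn sn Qn] /and3P[sr ss sQ] /andP[rs pQ] e.
have := IH s; rewrite /= sn Qn ss sQ pQ => /(_ isT isT isT e)[h1 h2 h3 h4 h5].
have [fst_count snd_count] := colrel_below sr ss sn rs.
rewrite h1 h2 snd_count (size_filter _ r) count_size h4 filter_all /=.
rewrite (sorted_filter leq_trans) //=; split=> //.
- by case: (Q) h3 => [|t Q2] //= ->; rewrite fst_count.
- by rewrite /grow /= -/(grow n _ (size s :: _)) h5 growrow_below.
Qed.

Definition ssytn n Q := [&& size Q == n, letters n Q, all (sorted leq) Q & sorted (colrel ltn) Q].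

Lemma grow_ssytn n Q la : ssytn n Q -> interlaces [seq size r | r <- Q] la ->
  [/\ ssytn n.+1 (grow n Q la), [seq size r | r <- grow n Q la] = la & shrink n (grow n Q la) = Q].
Proof.
case/and4P=> /eqP sz h1 h2 h3 hi; have [g1 g2 g3 g4 g5] := growP h1 h2 h3 hi.
split=> //; last by rewrite /shrink g5 -cats1 -sz take_size_cat.
by rewrite /ssytn g1 g2 g3 !andbT -(size_map (below n)) g5 size_rcons sz.
Qed.

Lemma shrink_ssytn n Q : ssytn n.+1 Q ->
  [/\ ssytn n (shrink n Q), interlaces [seq size r | r <- shrink n Q] [seq size r | r <- Q]
    & grow n (shrink n Q) [seq size r | r <- Q] = Q].
Proof.
case: Q => [|r Q] /and4P[//= /eqP[sz] h1 h2 h3].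
have e : below n (last r Q) = [::].
  apply/eqP; rewrite -size_eq0 size_filter -leqn0 leqNgt -has_count -all_predC.
  move: h2 => /= /andP[sr sQ].
  have := @last_ge 0 r Q sr sQ (all_predT _) h3; rewrite add0n sz.
  by apply: sub_all => x /=; lia.
have := shrink_aux h1 h2 h3 e; rewrite /shrink sz => -[g1 g2 g3 g4 g5]; split=> //.
by rewrite /ssytn g1 g2 g3 !andbT size_takel //= size_map sz.
Qed.

(** * The correspondence *)

Definition state := (seq bitrow * seq (seq nat))%type.

Definition step (PQ : state) (F : bitrow) : state :=
  let P := tab_insert PQ.1 F in (P, grow (size PQ.1) PQ.2 (map weight P)).

Definition rsk (Fs : seq bitrow) : state := foldl step ([::], [::]) Fs.

Fixpoint unrsk n (PQ : state) : seq bitrow :=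
  if n is m.+1 then
    let Q := shrink m PQ.2 in
    let PF := tab_delete (map size Q) PQ.1 in
    rcons (unrsk m (PF.1, Q)) PF.2
  else [::].

Section Rsk.
Variable L : nat.

(** The states that [n] insertions can reach: [rsk_good] and [unrsk_good] give the two
    inclusions. *)
Definition good n (PQ : state) :=
  [&& size PQ.1 == n, all (isrow L) PQ.1, sorted dyck_above PQ.1, ssytn n PQ.2
    & map size PQ.2 == map weight PQ.1].

Lemma step_good n PQ F : good n PQ -> isrow L F ->
  good n.+1 (step PQ F) /\
  unrsk n.+1 (step PQ F) = rcons (unrsk n PQ) F.
Proof.
case: PQ => P Q /and5P[/= /eqP sP rP dP sQ /eqP e] rF.
have [i1 i2 i3] := ins_tab rP dP rF.
rewrite /good /= sP.
have [|g1 g2 g3] := grow_ssytn (la := map weight (tab_insert P F)) sQ; first by rewrite e.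
by rewrite size_ins sP i1 i2 g1 g2 g3 e (del_ins rP rF) !eqxx.
Qed.

Lemma rsk_good Fs : all (isrow L) Fs -> good (size Fs) (rsk Fs) /\ unrsk (size Fs) (rsk Fs) = Fs.
Proof.
elim/last_ind: Fs => [|Fs F IH] //; rewrite all_rcons => /andP[rF /IH [g e]].
rewrite size_rcons /rsk foldl_rcons -/(rsk Fs).
by have [g1 ->] := step_good g rF; rewrite e.
Qed.

Lemma unrsk_good n PQ : good n PQ ->
  [/\ all (isrow L) (unrsk n PQ), size (unrsk n PQ) = n & rsk (unrsk n PQ) = PQ].
Proof.
elim: n PQ => [|n IH] [P Q] /and5P[/= /eqP sP rP dP sQ /eqP e].
  by rewrite (size0nil sP); case/and4P: sQ => /nilP ->.
have [h1 h2 h3] := shrink_ssytn sQ; rewrite e in h2 h3.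
case: (tab_delete _ _) (del_tab rP dP h2) => P1 F /= [d1 d2 d3 d4 d5].
have s1 : size P1 = n.
  by apply/eqP; rewrite -(size_map weight) d4 size_map; case/and4P: h1.
have [|u1 u2 u3] := IH (P1, shrink n Q).
  by rewrite /good /= s1 d1 d3 h1 d4 !eqxx.
rewrite all_rcons d2 u1 size_rcons u2 /rsk foldl_rcons -/(rsk _) u3; split=> //.
by rewrite /step /= d5 s1 h3.
Qed.

Lemma rsk_eqdi lo Fs : all (isrow L) Fs ->
  eqdi (flatten [seq ints lo F | F <- Fs]) (reading lo (rsk Fs).1).
Proof.
elim/last_ind: Fs => [|Fs F IH] //; rewrite all_rcons => /andP[rF rFs].
rewrite map_rcons flatten_rcons /rsk foldl_rcons -/(rsk Fs).
have [/and5P[_ rP _ _ _] _] := rsk_good rFs.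
apply: eqdi_trans (eqdi_ins _ rP rF).
exact: eqdi_cat (IH rFs) (eqdi_refl _).
Qed.

Lemma weight_row_insert X Y : isrow L X -> isrow L Y ->
  weight (row_insert X Y).1 + weight (row_insert X Y).2 = weight X + weight Y.
Proof.
move=> rX rY; have [rV rU] := row_insert_row rX rY.
by have := row_insert_cnt rX rY L; rewrite !(@prefix_countL L).
Qed.

Lemma sumn_ins P F : all (isrow L) P -> isrow L F ->
  sumn (map weight (tab_insert P F)) = sumn (map weight P) + weight F.
Proof.
elim: P F => [|T P IH] F /=; first by rewrite addn0.
move=> /andP[rT rP] rF; have [rV rU] := row_insert_row rT rF.
by have := weight_row_insert rT rF; rewrite IH //; lia.
Qed.

Lemma rsk_mult Fs i : all (isrow L) Fs ->
  count_mem i (flatten (rsk Fs).2) = weight (nth [::] Fs i).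
Proof.
elim/last_ind: Fs => [|Fs F IH]; first by rewrite nth_nil.
rewrite all_rcons => /andP[rF rFs]; rewrite /rsk foldl_rcons -/(rsk Fs).
have [/and5P[/eqP sP rP dP sQ /eqP e] _] := rsk_good rFs.
have [i1 i2 i3] := ins_tab rP dP rF.
have := @count_grow i (size Fs) (rsk Fs).2 (map weight (tab_insert (rsk Fs).1 F)).
rewrite e => /(_ i3); rewrite sumn_ins // IH // nth_rcons /= sP.
case: ltngtP => h /=; first lia.
- by rewrite [nth _ Fs i]nth_default /=; lia.
- by rewrite [nth _ Fs i]nth_default /= ?h; lia.
Qed.

End Rsk.

(** * Adding and removing empty rows *)

Section Padding.
Variable T : eqType.
Implicit Types X : seq (seq T).

Definition trim X := [seq r <- X | r != [::]].
Definition pad n X := X ++ nseq (n - size X) [::].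
Definition full X := all (fun r => r != [::]) X.

Lemma full_trim X : full (trim X).
Proof. exact: filter_all. Qed.

Lemma size_pad n X : size X <= n -> size (pad n X) = n.
Proof. by move=> h; rewrite size_cat size_nseq subnKC. Qed.

Lemma trim_pad n X : full X -> trim (pad n X) = X.
Proof.
move=> /all_filterP fX; rewrite /trim filter_cat fX; apply/eqP.
by rewrite -[X in _ == X]cats0 eqseq_cat // eqxx -size_eq0 size_filter count_nseq eqxx.
Qed.

(** Row lengths decrease weakly, so all empty rows are at the bottom. *)
Lemma pad_trim (R : rel T) X : sorted (colrel R) X -> pad (size X) (trim X) = X.
Proof.
elim: X => //= r X IH pX; case: eqP => [e|_] /=; last first.
  by rewrite /pad /= subSS -[in RHS](IH (path_sorted pX)).
move: pX; rewrite e => pX; have {pX} -> : X = nseq (size X) [::].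
  elim: X pX {IH} => //= s X IH /andP[/andP[+ _] pX].
  by rewrite leqn0 => /nilP e'; move: pX; rewrite e' => /IH <-.
rewrite size_nseq (_ : trim _ = [::]) //.
by apply/eqP; rewrite -size_eq0 size_filter count_nseq.
Qed.

Lemma flatten_trim X : flatten (trim X) = flatten X.
Proof. by elim: X => //= r X <-; case: eqP => [->|]. Qed.

Lemma flatten_rev_trim X : flatten (rev (trim X)) = flatten (rev X).
Proof. by rewrite /trim -filter_rev -/(trim _) flatten_trim. Qed.

Lemma flatten_pad n X : flatten (pad n X) = flatten X.
Proof. by rewrite flatten_cat; elim: (n - _) => /=; rewrite ?cats0. Qed.

Lemma sorted_pad (R : rel T) n X : sorted (colrel R) (pad n X) = sorted (colrel R) X.
Proof.
rewrite /pad; move: (n - _) => k; case: X => [|r X] /=.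
  by case: k => //= k; elim: k.
rewrite cat_path; have -> : path (colrel R) (last r X) (nseq k [::]).
  by elim: k (last r X) => //= k IH s; rewrite IH colrel_nil.
by rewrite andbT.
Qed.

Lemma sorted_trim (R : rel T) X : sorted (colrel R) X -> sorted (colrel R) (trim X).
Proof. by move=> h; rewrite -(sorted_pad _ (size X)) (pad_trim h). Qed.

Lemma tabE (R : rel T) X :
  partition_shaped X && columns_satisfy R X = full X && sorted (colrel R) X.
Proof.
rewrite /partition_shaped /columns_satisfy /shape all_map sorted_map -andbA.
congr (_ && _); first by apply: eq_all => -[].
by elim: X => //= r X; case: X => //= s X; rewrite /colrel => <-; rewrite andbACA.
Qed.

End Padding.

Lemma size_trim (T U : eqType) (X : seq (seq T)) (Y : seq (seq U)) :
  map size X = map size Y -> map size (trim X) = map size (trim Y).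
Proof.
have E (V : eqType) (Z : seq (seq V)) : map size (trim Z) = [seq k <- map size Z | k != 0].
  by rewrite filter_map; congr map; apply: eq_filter => -[].
by rewrite !E => ->.
Qed.

Lemma size_padE (T U : eqType) n (X : seq (seq T)) (Y : seq (seq U)) :
  map size X = map size Y -> map size (pad n X) = map size (pad n Y).
Proof.
move=> e; have sz : size X = size Y by rewrite -(size_map size) e size_map.
by rewrite /pad !map_cat !map_nseq e sz.
Qed.

Lemma is_dyck_tableauE P :
  is_dyck_tableau P =
  [&& full P, all dual_dyck P & sorted (colrel (fun a b : int => a <= b + 1)%R) P].
Proof. by rewrite /is_dyck_tableau andbCA tabE andbCA. Qed.

Lemma is_ssytE Q :
  is_ssyt Q = [&& full Q, all (sorted leq) Q & sorted (colrel ltn) Q].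
Proof. by rewrite /is_ssyt andbCA tabE andbCA. Qed.

(** * The bijection for entries in a fixed window of integers *)

Section Window.
Variables (S : {mset int}) (d : nat) (lo : int) (L : nat).
Hypothesis S_in_window : forall x, x \in (S : seq int) -> in_window lo L x.

Lemma perm_win (s : seq int) : perm_eq s S -> all (in_window lo L) s.
Proof. by move=> /perm_mem e; apply/allP => x; rewrite e => /S_in_window. Qed.

(* Since m_i(Q) = |F_i|, both sides determine the same number of insertions:
   see [bound_eq]. *)
Definition fbound (F : seq_family) := \max_(i <- finsupp F) i.+1.
Definition qbound (Q : seq (seq nat)) := \max_(a <- flatten Q) a.+1.

Definition frows (F : seq_family) : seq bitrow := [seq bits lo L (F i) | i <- iota 0 (fbound F)].

Definition to_tab (F : seq_family) : seq (seq int) * seq (seq nat) :=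
  let PQ := rsk (frows F) in (trim (map (ints lo) PQ.1), trim PQ.2).

Definition unrows (Fs : seq bitrow) : seq_family :=
  [fsfun i in [fset i in iota 0 (size Fs)]%fset => ints lo (nth [::] Fs i)].

Definition of_tab (PQ : seq (seq int) * seq (seq nat)) : seq_family :=
  let n := qbound PQ.2 in
  unrows (unrsk n (map (bits lo L) (pad n PQ.1), pad n PQ.2)).

Lemma unrowsE Fs i : unrows Fs i = ints lo (nth [::] Fs i).
Proof.
rewrite /unrows fsfunE inE mem_iota /= add0n.
by case: ltnP => // h; rewrite nth_default.
Qed.

Lemma bound_eq (F : seq_family) Q : (forall i, mult i Q = size (F i)) -> fbound F = qbound Q.
Proof.
move=> h; have E i : (i \in finsupp F) = (i \in flatten Q).
  by rewrite mem_finsupp -size_eq0 -h -lt0n -has_pred1 has_count.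
apply/eqP; rewrite eqn_leq; apply/andP; split; apply/bigmax_leqP_seq => i + _.
  by rewrite E => hi; apply: (leq_bigmax_seq _ hi).
by rewrite -E => hi; apply: (leq_bigmax_seq _ hi).
Qed.

Lemma fbound_out (F : seq_family) i : fbound F <= i -> F i = [::].
Proof.
move=> h; apply: fsfun_dflt; apply/negP => hi.
by have := @leq_bigmax_seq _ _ xpredT succn _ hi isT; rewrite -/(fbound F); lia.
Qed.

Lemma fconcatE (F : seq_family) n : (forall i, n <= i -> F i = [::]) ->
  fconcat F = flatten [seq F i | i <- iota 0 n].
Proof.
move=> h; rewrite /fconcat.
have -> : sort leq (finsupp F) = [seq i <- iota 0 n | i \in finsupp F].
  apply: (sorted_eq leq_trans anti_leq).
  - exact: (sort_sorted leq_total).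
  - by apply: sorted_filter; [exact: leq_trans | exact: iota_sorted].
  rewrite perm_sort; apply: uniq_perm; rewrite ?fset_uniq ?filter_uniq ?iota_uniq //.
  move=> i; rewrite mem_filter mem_iota /= add0n; case: (boolP (i \in _)) => //= hi.
  by apply/esym; rewrite ltnNge; apply: contraL hi => /h e; rewrite mem_finsupp e.
elim: (iota 0 n) => //= i s IH; case: (boolP (i \in _)) => hi /=; first by rewrite IH.
by rewrite IH (fsfun_dflt hi).
Qed.

Definition fvalid (F : seq_family) := is_dual_dyck_factorization S F && (di (fconcat F) == d).
Definition tvalid (PQ : seq (seq int) * seq (seq nat)) :=
  [&& is_dyck_tableau PQ.1, perm_eq (flatten PQ.1) S,
      di (row_reading PQ.1) == d, is_ssyt PQ.2 & shape PQ.2 == shape PQ.1].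

Lemma size_frows F : size (frows F) = fbound F.
Proof. by rewrite size_map size_iota. Qed.

Lemma frows_ok F : fvalid F -> all (isrow L) (frows F) /\
  forall i, ints lo (nth [::] (frows F) i) = F i.
Proof.
move=> /andP[/andP[pF dF] _].
have ok i : dual_dyck (F i) && all (in_window lo L) (F i).
  case: (finsuppP F i) => // hi; rewrite (allP dF) //; apply/allP => x xi.
  apply: (allP (perm_win pF)); apply/flattenP; exists (F i) => //.
  by apply/mapP; exists i; rewrite // mem_sort.
split; first by rewrite all_map; apply/allP => i _ /=; have /andP[] := ok i; exact: bits_row.
move=> i; case: (ltnP i (fbound F)) => h; last first.
  by rewrite nth_default ?size_frows // fbound_out.
rewrite (nth_map 0) ?size_iota // nth_iota // add0n.
by have /andP[] := ok i; exact: bitsK.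
Qed.

Lemma map_nth_iota (T : Type) (x0 : T) (U : Type) (f : T -> U) s :
  [seq f (nth x0 s i) | i <- iota 0 (size s)] = map f s.
Proof. by rewrite -[in RHS](mkseq_nth x0 s) /mkseq -map_comp. Qed.

Lemma reading_perm P : perm_eq (reading lo P) (flatten (map (ints lo) P)).
Proof.
elim: P => //= T P IH; rewrite reading_cons perm_catC perm_cat2l //.
Qed.

Lemma fconcat_frows F : fvalid F -> fconcat F = flatten (map (ints lo) (frows F)).
Proof.
move=> vF; have [_ e] := frows_ok vF.
rewrite (fconcatE (fun i => @fbound_out F i)) -size_frows -(map_nth_iota [::]).
by congr flatten; apply: eq_map => i; rewrite e.
Qed.

Lemma to_tab_mult F i : fvalid F -> mult i (to_tab F).2 = size (F i).
Proof.
move=> vF; have [rF e] := frows_ok vF.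
by rewrite /mult /to_tab /= flatten_trim (rsk_mult _ rF) -e size_ints.
Qed.

Lemma to_tab_valid F : fvalid F -> tvalid (to_tab F).
Proof.
move=> vF; have [rF e] := frows_ok vF.
have [/and5P[_ rP dP sQ /eqP eQ] _] := rsk_good rF.
have [pF dF] := rsk_eqdi lo rF.
rewrite -fconcat_frows // in pF dF.
move: (vF) => /andP[/andP[pS _] /eqP dS].
rewrite /to_tab; case: (rsk _) rP dP sQ eQ pF dF => P Q /= rP dP /and4P[_ _ sQ cQ] eQ pF dF.
apply/and5P; split=> /=.
- rewrite is_dyck_tableauE full_trim /=; apply/andP; split.
    apply/allP => _ /(mem_subseq (filter_subseq _ _)) /mapP[T TP ->].
    by rewrite dual_dyck_ints; have /andP[] := allP rP _ TP.
  apply: sorted_trim; rewrite sorted_map; apply: sub_sorted dP => T B /=.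
  by rewrite colrel_dyck_above.
- rewrite flatten_trim; apply: perm_trans pS.
  by rewrite perm_sym; apply: perm_trans pF (reading_perm P).
- by rewrite /row_reading flatten_rev_trim -map_rev -dF dS.
- rewrite is_ssytE full_trim sorted_trim // andbT /=.
  by apply/allP => r /(mem_subseq (filter_subseq _ _)) /(allP sQ).
- apply/eqP; apply: size_trim; rewrite eQ -map_comp.
  by apply: eq_map => T /=; rewrite size_ints.
Qed.

Lemma to_tabK F : fvalid F -> of_tab (to_tab F) = F.
Proof.
move=> vF; have [rF e] := frows_ok vF.
have bE : qbound (to_tab F).2 = fbound F.
  by apply/esym/bound_eq => i; apply: to_tab_mult.
have [/and5P[/eqP sP rP dP sQ /eqP eQ] uE] := rsk_good rF.
rewrite /of_tab bE -size_frows; apply/fsfunP => i.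
rewrite unrowsE -e; congr (ints lo (nth _ _ i)).
rewrite -[RHS]uE; congr unrsk; rewrite [RHS]surjective_pairing; congr pair.
  have <- : size (map (ints lo) (rsk (frows F)).1) = size (frows F) by rewrite size_map.
  rewrite (@pad_trim _ (fun a b : int => a <= b + 1)%R).
    rewrite -map_comp map_id_in // => T TP /=.
    by have /andP[/eqP sT _] := allP rP _ TP; rewrite -{1}sT intsK.
  by rewrite sorted_map; apply: sub_sorted dP => T B /=; rewrite colrel_dyck_above.
case/and4P: sQ => /eqP <- _ _ cQ; exact: pad_trim cQ.
Qed.

(** Makes padding to [qbound Q] rows possible: the last row is nonempty, and its entries are at
    least its index. *)
Lemma size_qbound Q : is_ssyt Q -> size Q <= qbound Q.
Proof.
rewrite is_ssytE => /and3P[fQ sQ cQ].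
case: Q fQ sQ cQ => // r Q fQ /= /andP[sr sQ] cQ.
have := @last_ge 0 r Q sr sQ (all_predT _) cQ; rewrite add0n.
have lr : last r Q \in r :: Q by rewrite mem_last.
have := allP fQ _ lr; case E: (last r Q) lr => [|a s] // lr _ /= /andP[ha _].
apply: leq_ltn_trans ha _; apply: (@leq_bigmax_seq _ _ xpredT succn) => //.
by apply/flattenP; exists (a :: s); rewrite ?mem_head.
Qed.

Section Back.
Variables (P : seq (seq int)) (Q : seq (seq nat)).
Hypothesis vPQ : tvalid (P, Q).
Let n := qbound Q.
Let PQ := (map (bits lo L) (pad n P), pad n Q).

Lemma back_rows : map (ints lo) PQ.1 = pad n P.
Proof.
case/and5P: vPQ => /=; rewrite is_dyck_tableauE => /and3P[_ dP _] pS _ _ _.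
rewrite -map_comp map_id_in // => r; rewrite mem_cat mem_nseq => /orP[rP|/andP[_ /eqP->]] /=.
  apply: bitsK; first exact: (allP dP).
  by apply/allP => x xr; apply: (allP (perm_win pS)); apply/flattenP; exists r.
by apply: bitsK.
Qed.

Lemma back_good : good L n PQ.
Proof.
have bE := back_rows.
case/and5P: vPQ => /= + + + /[dup] /size_qbound szQ; rewrite is_dyck_tableauE is_ssytE.
move=> /and3P[fP dP cP] pS _ /and3P[fQ sQ cQ] /eqP eS.
have szP : size P = size Q by rewrite -(size_map size) -[map size P]eS size_map.
apply/and5P; split=> /=.
- by rewrite size_map size_pad // szP.
- apply/allP => _ /mapP[r + ->]; rewrite mem_cat mem_nseq => /orP[rP|/andP[_ /eqP->]].
    apply: bits_row; first exact: (allP dP).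
    by apply/allP => x xr; apply: (allP (perm_win pS)); apply/flattenP; exists r.
  exact: bits_row.
- have : sorted (colrel (fun a b : int => a <= b + 1)%R) (map (ints lo) PQ.1).
    by rewrite bE sorted_pad.
  by rewrite sorted_map; apply: sub_sorted => T B /=; rewrite colrel_dyck_above.
- rewrite /ssytn size_pad // eqxx sorted_pad cQ andbT /=; apply/andP; split; apply/allP => r;
    rewrite mem_cat mem_nseq => /orP[rQ|/andP[_ /eqP->]] //; last exact: (allP sQ).
  apply/allP => a ar; apply: (@leq_bigmax_seq _ _ xpredT succn) => //.
  by apply/flattenP; exists r.
- have e2 : map size (pad n P) = map weight PQ.1.
    by rewrite -bE -map_comp; apply: eq_map => T /=; rewrite size_ints.
  by rewrite -e2; apply/eqP; apply: size_padE.
Qed.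

Lemma of_tabE : of_tab (P, Q) = unrows (unrsk n PQ). Proof. by []. Qed.

Lemma of_tab_frows : frows (of_tab (P, Q)) = unrsk n PQ /\
  fconcat (of_tab (P, Q)) = flatten (map (ints lo) (unrsk n PQ)).
Proof.
have [u1 u2 u3] := unrsk_good back_good.
(* The recovered family also satisfies m_i(Q) = |F_i|, so [frows] reads exactly the [n] rows
   produced by [unrsk]. *)
have bE : fbound (of_tab (P, Q)) = n.
  apply: bound_eq => i; rewrite of_tabE unrowsE size_ints -(rsk_mult _ u1) u3 /=.
  by rewrite flatten_pad.
split.
  rewrite /frows bE -{1}u2 -[RHS](mkseq_nth [::]) /mkseq; apply/eq_in_map => i.
  rewrite mem_iota add0n => /= hi; rewrite of_tabE unrowsE.
  have /andP[/eqP sz _] := allP u1 _ (mem_nth [::] hi).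
  by rewrite -{1}sz intsK.
rewrite (@fconcatE _ n); last by move=> i; rewrite -{1}bE; apply: fbound_out.
by rewrite -(map_nth_iota [::]) u2; congr flatten; apply: eq_map => i; rewrite of_tabE unrowsE.
Qed.

Lemma of_tab_valid : fvalid (of_tab (P, Q)).
Proof.
have [u1 u2 u3] := unrsk_good back_good; have [fE fcE] := of_tab_frows.
have [] := rsk_eqdi lo u1; rewrite u3 -fcE => p1 d1.
case/and5P: (vPQ) => /= _ pS /eqP dS _ _.
apply/andP; split; last first.
  have fP : full P by case/and5P: vPQ => /=; rewrite is_dyck_tableauE => /and3P[].
  by rewrite d1 /reading map_rev back_rows -dS /row_reading -(flatten_rev_trim (pad n P)) trim_pad.
apply/andP; split.
  apply: perm_trans p1 _; apply: perm_trans (reading_perm _) _.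
  by rewrite back_rows flatten_pad.
apply/allP => i _; rewrite of_tabE unrowsE.
case: (ltnP i (size (unrsk n PQ))) => hi; last by rewrite nth_default.
by rewrite dual_dyck_ints; have /andP[] := allP u1 _ (mem_nth [::] hi).
Qed.

Lemma of_tabK : to_tab (of_tab (P, Q)) = (P, Q).
Proof.
have [u1 u2 u3] := unrsk_good back_good; have [fE fcE] := of_tab_frows.
rewrite /to_tab fE u3 back_rows /=.
case/and5P: vPQ => /=; rewrite is_dyck_tableauE is_ssytE => /and3P[fP _ _] _ _ /and3P[fQ _ _] _.
by rewrite !trim_pad.
Qed.

End Back.
End Window.

Lemma window_exists (s : seq int) : exists lo L, forall x, x \in s -> in_window lo L x.
Proof.
(* With K the largest absolute value, the window is the interval from -K to K, of 2K + 1
   integers. *)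
exists (- (\max_(x <- s) `|x|%N)%:Z)%R, (\max_(x <- s) `|x|%N).*2.+1 => x xs.
have := @leq_bigmax_seq _ _ xpredT absz _ xs isT; rewrite /in_window.
by set K := \max_(_ <- _) _; lia.
Qed.

Theorem theorem3p18 (S : {mset int}) (d : nat) :
  exists phi : dual_dyck_factorization S d -> tableau_pair S d,
    bijective phi /\
    forall (F : dual_dyck_factorization S d) (i : nat),
      mult i (sval (phi F)).2 = size (sval F i).
Proof.
(* The window depends on [S] alone, so both directions encode rows by bit words of the same
   length. *)
have [lo [L win]] := window_exists S.
have ok_of (T : tableau_pair S d) : fvalid S d (of_tab lo L (sval T)).
  by case: T => -[P Q] h; apply: of_tab_valid.
exists (fun F => exist _ (to_tab lo L (sval F)) (to_tab_valid win (valP F))).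
split; last by move=> F i /=; exact: (to_tab_mult win i (valP F)).
exists (fun T => exist _ (of_tab lo L (sval T)) (ok_of T)) => [F|T]; apply: val_inj => /=.
  exact: (to_tabK win (valP F)).
by case: T => -[P Q] h; exact: (of_tabK win h).
Qed.
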